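(* Let $\mathcal L\simeq\mathfrak{gl}(\mathbb R^6)$ be the family of $7$-dimensional almost Abelian Lie algebras (parametrized by $A$). The subfamily $\mathcal L_{\mathrm{coclosed}}\simeq\mathfrak{sp}(\mathbb R^6)\subset\mathcal L$ of coclosed $\mathrm G_2$-structures is invariant under the bracket flow $$\frac{d}{dt}A=q_A\,A-[Q_A^{\mathfrak h},A],$$ which there becomes equivalent to the following ODE for a one-parameter family of matrices $A=A(t)\in\mathfrak{sp}(\mathbb R^6)$: $$\frac{d}{dt}A=-\Big(\tfrac12\operatorname{tr}(S_A^2)+\tfrac14(\operatorname{tr}JA)^2\Big)A+\tfrac12[A,[A,A^t]]+\tfrac12[A,S_A\circ_6S_A].$$
   Context: Almost Abelian setting: for $A\in\mathfrak{gl}(\mathbb R^6)$ let $(\mathfrak g,A)$ be the Lie algebra $\mathbb R^7=\mathfrak h\oplus\mathbb Re_7$, $\mathfrak h=\mathrm{span}(e_1,\dots,e_6)\cong\mathbb R^6$ an Abelian ideal, with $\mathrm{ad}(e_7)|_{\mathfrak h}=A$. It carries the fixed $\mathrm G_2$-structure $\varphi=\omega\wedge e^7+\rho^+$ with orthonormal basis $e_1,\dots,e_7$, $\omega=e^{12}+e^{34}+e^{56}$, $\rho^+=e^{135}-e^{146}-e^{245}-e^{236}$, dual form $\psi=*\varphi=\frac12\omega^2+\rho^-\wedge e^7$ with $\rho^-=-e^{246}+e^{235}+e^{145}+e^{136}$; $J$ is the complex structure on $\mathbb R^6$ with $\omega=\langle J\cdot,\cdot\rangle$. The structure is coclosed ($\mathrm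 d\psi=0$) iff $A\in\mathfrak{sp}(\mathbb R^6)=\{A:AJ+JA^t=0\}$. Notation: $S_A=\frac12(A+A^t)$; $(S\circ_6S)_{ab}=S_{mn}S_{pq}\rho^+_{mpa}\rho^+_{nqb}$ (sum over repeated indices). For $B\in\mathfrak{gl}(\mathfrak g)$, $\theta(B)\psi=-\psi(B\cdot,\cdot,\cdot,\cdot)-\dots-\psi(\cdot,\cdot,\cdot,B\cdot)$. For $A\in\mathfrak{sp}(\mathbb R^6)$, $Q_A$ is the (unique) symmetric endomorphism of $\mathfrak g$ with $\Delta_A\psi=\theta(Q_A)\psi$, where $\Delta_A=\mathrm d\mathrm d^*+\mathrm d^*\mathrm d$ is the Hodge Laplacian of $(\mathfrak g,A,\varphi)$ on left-invariant forms; it is block diagonal with respect to $\mathfrak h\oplus\mathbb Re_7$, and $Q_A^{\mathfrak h}$, $q_A$ denote its blocks on $\mathfrak h$ and $\mathbb Re_7$. Invariance of $\mathfrak{sp}(\mathbb R^6)$ means that the velocity $q_AA-[Q_A^{\mathfrak h},A]$ lies in $\mathfrak{sp}(\mathbb R^6)$ for $A\in\mathfrak{sp}(\mathbb R^6)$, so solutions starting in $\mathfrak{sp}(\mathbb R^6)$ stay there. *)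

(* Defs.v *)
From HB Require Import structures.
From mathcomp Require Import all_boot all_order all_fingroup all_algebra.
From mathcomp Require Import all_classical all_reals all_analysis.

Set Implicit Arguments.
Unset Strict Implicit.
Unset Printing Implicit Defensive.

Import Order.TTheory GRing.Theory Num.Theory.
Import numFieldNormedType.Exports.
Local Open Scope ring_scope.

(* Left-invariant k-forms, seen as functions of k vectors of R^7.  The type is
   that of all k-cochains; the forms below are multilinear and alternating by
   construction, and the operators preserve this property. *)
Definition form (R : realType) (k : nat) := ('I_k -> 'cV[R]_7) -> R.

Section AlmostAbelian.
Variable R : realType.
Implicit Type A : 'M[R]_6.

(* basis i is e_(i+1): ordinals are counted from 0, labels from 1. *)
Definition basis (i : 'I_7) : 'cV[R]_7 := delta_mx i 0.

Definition basis_h (i : 'I_6) : 'cV[R]_7 := basis (@lshift 6 1 i).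

(* e^{i_1...i_k}, for 1-based labels I = [:: i_1; ...; i_k], normalised by
   e^{ij}(x, y) = x_i y_j - x_j y_i. *)
Definition dx (I : seq nat) : form R (size I) := fun x =>
  \det (\matrix_(a < size I, b < size I) x a (inord (nth 0%N I b).-1) 0).
Arguments dx I x : clear implicits.

Definition wedge (k l : nat) (alpha : form R k) (beta : form R l) :
    form R (k + l) := fun x =>
  (k`!%:R * l`!%:R)^-1 * \sum_(s : 'S_(k + l))
    (-1) ^+ s * alpha (fun i => x (s (lshift l i)))
              * beta (fun j => x (s (rshift k j))).

Definition omega : form R 2 :=
  dx [:: 1; 2]%N \+ dx [:: 3; 4]%N \+ dx [:: 5; 6]%N.

Definition rho_plus : form R 3 :=
  dx [:: 1; 3; 5]%N \- dx [:: 1; 4; 6]%N \- dx [:: 2; 4; 5]%N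
    \- dx [:: 2; 3; 6]%N.

Definition phi : form R 3 := wedge omega (dx [:: 7]%N) \+ rho_plus.

(* The volume form e^{1234567}, applied to a list of 7 vectors. *)
Definition vol (x : seq 'cV[R]_7) : R :=
  \det (\matrix_(a < 7, b < 7) nth 0 x b a 0).

(* ( *alpha)(x_1..x_l) =
     1/k! sum_f alpha(e_f1..e_fk) vol(e_f1..e_fk, x_1..x_l),
   so that alpha /\ *beta = <alpha, beta> vol.  The target degree l is kept as
   a parameter to avoid casts; only k + l = 7 is meaningful. *)
Definition hodge (k l : nat) (alpha : form R k) : form R l := fun x =>
  (k`!%:R)^-1 * \sum_(f : {ffun 'I_k -> 'I_7})
    alpha (fun p => basis (f p))
    * vol ([seq basis (f p) | p <- enum 'I_k] ++ [seq x q | q <- enum 'I_l]).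
Arguments hodge {k} l alpha x.

Definition psi : form R 4 := hodge 4 phi.

Definition coordinate7 (x : 'cV[R]_7) : R := x (inord 6) 0.

Definition ad_e7 A : 'M[R]_7 := block_mx A 0 0 (0 : 'M[R]_1).

Definition bracket A (x y : 'cV[R]_7) : 'cV[R]_7 :=
  coordinate7 x *: (ad_e7 A *m y) - coordinate7 y *: (ad_e7 A *m x).

(* Chevalley-Eilenberg differential
     d alpha (x_0..x_k) =
       sum_(i < j) (-1)^(i+j) alpha([x_i, x_j], .., no x_i, .., no x_j, ..).
   Here [x_i, x_j] occupies the slot of x_i rather than the first one, which
   absorbs the sign (-1)^i; lift j skips the index j. *)
Definition ext_d A (k : nat) (alpha : form R k) : form R k.+1 := fun x =>
  \sum_(j < k.+1) \sum_(i < k | (i < j)%N)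
    (-1) ^+ j * alpha (fun m => if m == i
                                then bracket A (x (lift j i)) (x j)
                                else x (lift j m)).

(* d^* = (-1)^p * d * on p-forms in dimension 7, for p = k.+1 <= 7. *)
Definition codiff A (k : nat) (alpha : form R k.+1) : form R k := fun x =>
  (-1) ^+ k.+1 * hodge k (ext_d A (hodge (7 - k.+1) alpha)) x.

Definition hodge_laplacian A (k : nat) (alpha : form R k.+1) : form R k.+1 :=
  ext_d A (codiff A alpha) \+ codiff A (ext_d A alpha).

Definition theta (B : 'M[R]_7) (k : nat) (alpha : form R k) : form R k :=
  fun x => - \sum_(i < k) alpha (fun m => if m == i then B *m x m else x m).

Definition coclosed A : Prop := forall x, ext_d A psi x = 0.

(* The matrix of J, from <J e_i, e_j> = omega (e_i, e_j). *)
Definition J : 'M[R]_6 := \matrix_(j, i)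
  omega (tnth [tuple basis_h i; basis_h j]).

Definition sp6 A : Prop := A *m J + J *m A^T = 0.

Definition is_laplacian_endo A (Q : 'M[R]_7) : Prop :=
  Q^T = Q /\ forall x, hodge_laplacian A psi x = theta Q psi x.

(* Q_A: the matrix characterised by is_laplacian_endo.  The default value 0 is
   irrelevant on sp(R^6), where such a matrix exists and is unique. *)
Definition laplacian_endo A : 'M[R]_7 := xget 0 [set Q | is_laplacian_endo A Q].

Definition Qh A : 'M[R]_6 := ulsubmx (laplacian_endo A : 'M[R]_(6 + 1)).
Definition q A : R := drsubmx (laplacian_endo A : 'M[R]_(6 + 1)) 0 0.

Definition commutator (B C : 'M[R]_6) : 'M[R]_6 := B *m C - C *m B.

Definition bracket_flow A : 'M[R]_6 := q A *: A - commutator (Qh A) A.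

Definition sym_part A : 'M[R]_6 := 2^-1 *: (A + A^T).

Definition rho_coef (m p a : 'I_6) : R :=
  rho_plus (tnth [tuple basis_h m; basis_h p; basis_h a]).

Definition circ6 (S : 'M[R]_6) : 'M[R]_6 := \matrix_(a, b)
  \sum_(m < 6) \sum_(n < 6) \sum_(p < 6) \sum_(q < 6)
    S m n * S p q * rho_coef m p a * rho_coef n q b.

Definition coclosed_flow A : 'M[R]_6 :=
  - (2^-1 * \tr (sym_part A *m sym_part A) + 4^-1 * (\tr (J *m A)) ^+ 2) *: A
  + 2^-1 *: commutator A (commutator A A^T)
  + 2^-1 *: commutator A (circ6 (sym_part A)).

Definition solves (F : 'M[R]_6 -> 'M[R]_6) (I : set R) (A : R -> 'M[R]_6) :=
  forall t : R, I t -> is_derive t 1 A (F (A t)).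

End AlmostAbelian.

(* Main.v *)
Require Import Defs.
From mathcomp Require Import all_boot all_order all_fingroup all_algebra.
From mathcomp Require Import all_classical all_reals all_analysis.
From mathcomp Require Import ring lra zify.
Import numFieldNormedType.Exports.
Import Defs.
Import Order.TTheory GRing.Theory Num.Theory.

Set Implicit Arguments.
Unset Strict Implicit.
Unset Printing Implicit Defensive.
Local Open Scope ring_scope.

(** Write A' = ad_e7 A for the derivation of the Lie algebra that extends A by 0
    on e_7, and S, K for the symmetric and the skew part of A.  Since h is an
    Abelian ideal, only brackets with e_7 contribute to the differential, and
    d alpha = e^7 /\ theta(A') alpha (ext_dE).

    Coclosed structures.  A form e^7 /\ beta is zero if and only if beta vanishes
    on h.  For beta = theta(A') psi the restriction to h is omega /\ theta(A) omega,
    as psi restricts to half the square of omega.  The exterior product with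
    omega is injective on the 2-forms of R^6 (omega_wedge_dot_eq0), so that psi
    is closed if and only if theta(A) omega = 0, that is, A is in sp(6)
    (coclosed_sp6).

    The Laplacian.  If A is in sp(6), so are A^T, S and K, and tr A = 0.  The star
    exchanges phi and psi (psiE, hodge_psi), turns theta(B) into
    - theta(B^T) - tr B (hodge_theta), and the exterior product with e^7 into
    the interior product with e_7 up to sign (hodge_ext7).  Hence
    Delta psi = d d^* psi = theta(A') theta(A'^T) psi (hodge_laplacian_psi).

    The endomorphism Q_A.  As theta is a representation (theta_commutator),
      theta(A') theta(A'^T) = theta(S')^2 - theta(K')^2 + theta([K', S']),
    where [K, S] = [A, A^T] / 2.  With P the projection to the line of e_7,
      theta(S')^2 psi = theta((S o S)') psi / 2 - tr(S^2) theta(P) psi / 2,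
      theta(K')^2 psi = (tr J K)^2 theta(P) psi / 4
    (theta2_sym, theta2_skew).  These are polynomial identities in the twelve
    free entries of S and the nine of K.  Therefore Delta psi = theta(Q) psi for
    the block diagonal symmetric matrix Q with blocks
      ([A, A^T] + S o S) / 2   and   - tr(S^2) / 2 - (tr J A)^2 / 4,
    and Q is Q_A because B |-> theta(B) psi is injective on symmetric matrices
    (theta_psi_inj).

    The flow.  Inserting these blocks into the velocity of the bracket flow gives
    the right-hand side of the second equation at every point of sp(6)
    (bracket_flowE), so that along curves in sp(6) both equations are the same.
    The velocity lies in sp(6), because sp(6) is closed under transposition and
    commutators and contains S o S (sp6_bracket_flow). *)

(** * Alternating multilinear forms *)

Section AlternatingForms.
Variable R : realType.
Local Notation V := 'cV[R]_7.
Implicit Types (k l : nat) (B : 'M[R]_7).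

Definition upd k (x : 'I_k -> V) (i : 'I_k) (v : V) : 'I_k -> V :=
  fun m => if m == i then v else x m.

Definition is_alternating k (alpha : form R k) : Prop :=
  forall x (s : 'S_k), alpha (x \o s) = (-1) ^+ s * alpha x.

Definition is_multilinear k (alpha : form R k) : Prop :=
  forall x i a u v,
    alpha (upd x i (a *: u + v)) = a * alpha (upd x i u) + alpha (upd x i v).

Lemma upd_id k (x : 'I_k -> V) i : upd x i (x i) = x.
Proof. by apply/funext => m; rewrite /upd; case: eqP => // ->. Qed.

Lemma upd_same k (x : 'I_k -> V) i u v : upd (upd x i u) i v = upd x i v.
Proof. by apply/funext => m; rewrite /upd; case: eqP. Qed.

Lemma updC k (x : 'I_k -> V) i j u v : i != j ->
  upd (upd x i u) j v = upd (upd x j v) i u.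
Proof.
move=> ij; apply/funext => m; rewrite /upd.
by case: (m =P j) => [->|//]; rewrite eq_sym (negbTE ij).
Qed.

Lemma upd_comp k (x : 'I_k -> V) (s : 'S_k) i v :
  upd (x \o s) i v = upd x (s i) v \o s.
Proof. by apply/funext => m; rewrite /upd /= (inj_eq perm_inj). Qed.

Lemma upd_at k (x : 'I_k -> V) i v : upd x i v i = v.
Proof. by rewrite /upd eqxx. Qed.

Lemma alternating_eq0 k (alpha : form R k) x i j : is_alternating alpha ->
  i != j -> x i = x j -> alpha x = 0.
Proof.
move=> alt ij xij; have := alt x (tperm i j).
have -> : x \o tperm i j = x.
  by apply/funext => m /=; case: tpermP => // ->.
by rewrite odd_tperm ij expr1 => ?; lra.
Qed.

Lemma multilinear0 k (alpha : form R k) x i : is_multilinear alpha ->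
  alpha (upd x i 0) = 0.
Proof.
by move=> ml; have := ml x i (-1) 0 0; rewrite scaler0 addr0 => ?; lra.
Qed.

Lemma multilinear_sum k (alpha : form R k) x i n (a : 'I_n -> R) u :
  is_multilinear alpha ->
  alpha (upd x i (\sum_m a m *: u m)) = \sum_m a m * alpha (upd x i (u m)).
Proof.
move=> ml; elim/big_rec2: _ => [|m y v _ <-]; first exact: multilinear0.
by rewrite ml.
Qed.

Lemma basis_expansion (v : V) : v = \sum_m v m 0 *: basis R m.
Proof.
rewrite {1}[v]matrix_sum_delta; apply: eq_bigr => m _.
by rewrite big_ord1.
Qed.

Lemma mul_basis B m : B *m basis R m = \sum_n B n m *: basis R n.
Proof. by rewrite -colE [LHS]basis_expansion; apply: eq_bigr => n _; rewrite mxE. Qed.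

(** The arguments are expanded in the basis one after the other; n bounds the
    number of arguments that are not yet basis vectors. *)
Lemma multilinear_eq0 k (alpha : form R k) : is_multilinear alpha ->
  (forall f : 'I_k -> 'I_7, alpha (basis R \o f) = 0) -> forall x, alpha x = 0.
Proof.
move=> ml e0.
suff H n : (n <= k)%N -> forall x : 'I_k -> V,
    (forall i : 'I_k, (n <= i)%N -> exists m, x i = basis R m) -> alpha x = 0.
  by move=> x; apply: (H k) => // i; rewrite leqNgt ltn_ord.
elim: n => [|n IH] nk x xb.
  have [f xf] := boolp.choice (fun i => xb i (leq0n i)).
  by rewrite (_ : x = basis R \o f) ?e0 //; apply/funext.
rewrite -[x](upd_id x (Ordinal nk)) [x (Ordinal nk)]basis_expansion.
rewrite multilinear_sum // big1 // => m _.
rewrite IH ?mulr0 ?(ltnW nk) // => i ni; rewrite /upd; case: eqP => [_|].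
  by exists m.
move=> /eqP; rewrite -val_eqE /= => ine; apply: xb.
by rewrite ltn_neqAle eq_sym ine.
Qed.

Definition increasing k (f : 'I_k -> 'I_7) : Prop :=
  forall i j : 'I_k, (i < j)%N -> (f i < f j)%N.

Lemma sorting_perm k (f : 'I_k -> 'I_7) : injective f ->
  exists s : 'S_k, increasing (f \o s).
Proof.
move=> injf; set t : k.-tuple 'I_7 := [tuple f i | i < k].
have szs : size (sort (fun a b : 'I_7 => (a <= b)%N) t) == k.
  by rewrite size_sort size_tuple.
have : perm_eq (Tuple szs) t by rewrite /= perm_sort.
move=> /tuple_permP[s /= sE]; exists s.
have tot : total (fun a b : 'I_7 => (a <= b)%N) by move=> a b; apply: leq_total.
have srt := sort_sorted tot t.
have nthE (i : 'I_k) : nth (f i) (sort (fun a b : 'I_7 => (a <= b)%N) t) i = f (s i).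
  by rewrite sE (nth_map i) ?size_enum_ord ?ltn_ord // nth_ord_enum tnth_mktuple.
move=> i j ij /=; rewrite ltn_neqAle; apply/andP; split.
  apply: contraTneq ij => /val_inj/injf/perm_inj ->.
  by rewrite ltnn.
rewrite -(nthE i) -(nthE j).
rewrite (set_nth_default (f i) (f j)) ?(eqP szs) //.
apply: (sorted_leq_nth _ _ (f i) srt) => //=; rewrite ?inE ?(eqP szs) //.
- by move=> a b c; apply: leq_trans.
- exact: ltnW.
Qed.

(** Sorting the arguments changes an alternating form by a sign, and equal
    arguments kill it. *)
Lemma alternating_basis_eq0 k (alpha : form R k) (f : 'I_k -> 'I_7) :
  is_alternating alpha ->
  (forall s : 'S_k, increasing (f \o s) -> alpha (basis R \o f \o s) = 0) ->
  alpha (basis R \o f) = 0.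
Proof.
move=> alt e0; have [/injectiveP/sorting_perm[s inc]|] := boolP (injectiveb f).
  have := e0 s inc; rewrite alt => /eqP.
  by rewrite mulf_eq0 signr_eq0 => /eqP.
move=> /injectivePn[i [j ij fij]].
by apply: (alternating_eq0 alt ij); rewrite /= fij.
Qed.

Lemma alternating_multilinear_eq0 k (alpha : form R k) :
  is_alternating alpha -> is_multilinear alpha ->
  (forall f, increasing f -> alpha (basis R \o f) = 0) -> forall x, alpha x = 0.
Proof.
move=> alt ml e0; apply: multilinear_eq0 => // f.
by apply: alternating_basis_eq0 => // s inc; rewrite -compA e0.
Qed.

End AlternatingForms.

(** * Interior and exterior multiplication, derivations *)

Section Operators.
Variable R : realType.
Local Notation V := 'cV[R]_7.
Implicit Types (k l : nat) (B : 'M[R]_7).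

Definition ins k (j : 'I_k.+1) (v : V) (x : 'I_k -> V) : 'I_k.+1 -> V :=
  fun m => oapp x v (unlift j m).

Lemma ins_at k (j : 'I_k.+1) v (x : 'I_k -> V) : ins j v x j = v.
Proof. by rewrite /ins unlift_none. Qed.

Lemma ins_lift k (j : 'I_k.+1) v (x : 'I_k -> V) m : ins j v x (lift j m) = x m.
Proof. by rewrite /ins liftK. Qed.

Lemma eq_ins k (j : 'I_k.+1) (x y : 'I_k.+1 -> V) :
  x j = y j -> (forall m, x (lift j m) = y (lift j m)) -> x = y.
Proof. by move=> e0 e; apply/funext => m; case: (unliftP j m) => [m' ->|->]. Qed.

Lemma ins_id k (j : 'I_k.+1) (x : 'I_k.+1 -> V) : ins j (x j) (x \o lift j) = x.
Proof. by apply: (@eq_ins _ j) => [|m]; rewrite ?ins_at ?ins_lift. Qed.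

Lemma ins_lift_comp k (j : 'I_k.+1) v (x : 'I_k -> V) : ins j v x \o lift j = x.
Proof. by apply/funext => m /=; rewrite ins_lift. Qed.

Lemma upd_ins_lift k (j : 'I_k.+1) v (x : 'I_k -> V) i w :
  upd (ins j v x) (lift j i) w = ins j v (upd x i w).
Proof.
apply: (@eq_ins _ j) => [|m]; first by rewrite /upd (negbTE (neq_lift _ _)) !ins_at.
by rewrite /upd (inj_eq lift_inj) !ins_lift.
Qed.

(** The permutation lift_perm j l 1 sends j to l and preserves the order of
    the other positions. *)
Lemma ins_perm k (j l : 'I_k.+1) v (x : 'I_k -> V) :
  ins j v x = ins l v x \o lift_perm j l 1.
Proof.
apply: (@eq_ins _ j) => [|m] /=.
  by rewrite lift_perm_id !ins_at.
by rewrite lift_perm_lift perm1 !ins_lift.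
Qed.

Lemma alternating_ins k (alpha : form R k.+1) (j l : 'I_k.+1) v x :
  is_alternating alpha -> alpha (ins j v x) = (-1) ^+ (j + l) * alpha (ins l v x).
Proof.
by move=> alt; rewrite (ins_perm j l) alt odd_lift_perm odd_perm1 addbF -oddD signr_odd.
Qed.

(** Each term of an exterior product with e^7 singles out one argument; this
    factorization of s separates what happens to that argument from what
    happens to the others. *)
Lemma perm_lift_decomposition k (s : 'S_k.+1) j :
  exists t : 'S_k, s = lift_perm j (s j) t.
Proof.
have sj m : s j != s (lift j m) by rewrite (inj_eq perm_inj) neq_lift.
pose f m := odflt m (unlift (s j) (s (lift j m))).
have fE m : lift (s j) (f m) = s (lift j m).
  by rewrite /f; case: unliftP (sj m) => [m' -> //|->]; rewrite eqxx.
have injf : injective f.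
  by move=> m n /(congr1 (lift (s j))); rewrite !fE => /perm_inj/lift_inj.
exists (perm injf); apply/permP => m; case: (unliftP j m) => [m' ->|->].
  by rewrite lift_perm_lift permE fE.
by rewrite lift_perm_id.
Qed.

Definition e7 : V := basis R (inord 6).

Definition iota7 k (alpha : form R k.+1) : form R k := fun x => alpha (ins ord0 e7 x).

(** The exterior product of e^7 with beta, expanded along the argument that
    e^7 receives. *)
Definition ext7 k (beta : form R k) : form R k.+1 := fun x =>
  \sum_(j < k.+1) (-1) ^+ j * coordinate7 (x j) * beta (x \o lift j).

Lemma thetaE B k (alpha : form R k) x :
  theta B alpha x = - \sum_i alpha (upd x i (B *m x i)).
Proof.
congr (- _); apply: eq_bigr => i _; congr (alpha _).
by apply/funext => m; rewrite /upd; case: eqP => // ->.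
Qed.

Lemma alternating_theta B k (alpha : form R k) :
  is_alternating alpha -> is_alternating (theta B alpha).
Proof.
move=> alt x s; rewrite !thetaE mulrN mulr_sumr; congr (- _).
rewrite [RHS](reindex_inj (@perm_inj _ s)); apply: eq_bigr => i _ /=.
by rewrite upd_comp alt.
Qed.

Lemma multilinear_theta B k (alpha : form R k) :
  is_multilinear alpha -> is_multilinear (theta B alpha).
Proof.
move=> ml x i a u v; rewrite !thetaE mulrN -opprD mulr_sumr -big_split.
congr (- _); apply: eq_bigr => p _ /=.
have [-> | pi] := eqVneq p i.
  by rewrite !upd_at !upd_same mulmxDr -scalemxAr ml.
have upd_p w : upd x i w p = x p by rewrite /upd (negbTE pi).
by rewrite !upd_p !(updC _ _ _ (_ : i != p)) 1?eq_sym // ml.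
Qed.

Lemma thetaDl B C k (alpha : form R k) x : is_multilinear alpha ->
  theta (B + C) alpha x = theta B alpha x + theta C alpha x.
Proof.
move=> ml; rewrite !thetaE -opprD -big_split; congr (- _); apply: eq_bigr => i _ /=.
by rewrite mulmxDl -[B *m _]scale1r ml mul1r scale1r.
Qed.

Lemma thetaZl a B k (alpha : form R k) x : is_multilinear alpha ->
  theta (a *: B) alpha x = a * theta B alpha x.
Proof.
move=> ml; rewrite !thetaE mulrN mulr_sumr; congr (- _); apply: eq_bigr => i _ /=.
by rewrite -scalemxAl -[_ *: _]addr0 ml multilinear0 // addr0.
Qed.

Lemma theta_lin B a k (alpha beta gamma : form R k) x :
  (forall y, gamma y = alpha y + a * beta y) ->
  theta B gamma x = theta B alpha x + a * theta B beta x.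
Proof.
move=> e; rewrite !thetaE mulrN mulr_sumr -opprD -big_split; congr (- _).
by apply: eq_bigr => i _; rewrite e.
Qed.

Lemma theta_theta B C k (alpha : form R k) x :
  theta B (theta C alpha) x = \sum_i alpha (upd x i (C *m (B *m x i))) +
    \sum_i \sum_(j | j != i) alpha (upd (upd x i (B *m x i)) j (C *m x j)).
Proof.
rewrite thetaE -sumrN -big_split; apply: eq_bigr => i _ /=.
rewrite thetaE opprK (bigD1 i) //= upd_at upd_same; congr (_ + _).
by apply: eq_bigr => j /negbTE ji; rewrite (_ : upd x i _ j = x j) // /upd ji.
Qed.

(** Terms in which B and C act on two different arguments are symmetric in B
    and C and cancel.  Where both act on one argument, C B - B C remains, and
    the sign in the definition of theta turns it into B C - C B. *)
Lemma theta_commutator B C k (alpha : form R k) x : is_multilinear alpha ->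
  theta B (theta C alpha) x - theta C (theta B alpha) x =
  theta (B *m C - C *m B) alpha x.
Proof.
move=> ml; rewrite !theta_theta [X in _ + X - _](exchange_big_dep xpredT) //=.
have -> : \sum_j \sum_(i | j != i) alpha (upd (upd x i (B *m x i)) j (C *m x j)) =
   \sum_j \sum_(i | i != j) alpha (upd (upd x j (C *m x j)) i (B *m x i)).
  apply: eq_bigr => j _; apply: eq_big => i; first by rewrite eq_sym.
  by rewrite eq_sym => ij; rewrite updC // eq_sym.
rewrite opprD addrACA subrr addr0 -sumrB thetaE -sumrN; apply: eq_bigr => i _.
have -> : (B *m C - C *m B) *m x i = -1 *: (C *m (B *m x i)) + B *m (C *m x i).
  by rewrite mulmxBl -!mulmxA scaleN1r addrC.
by rewrite ml; ring.
Qed.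

Lemma multilinear_iota7 k (alpha : form R k.+1) :
  is_multilinear alpha -> is_multilinear (iota7 alpha).
Proof. by move=> ml x i a u v; rewrite /iota7 -!upd_ins_lift ml. Qed.

Lemma alternating_iota7 k (alpha : form R k.+1) :
  is_alternating alpha -> is_alternating (iota7 alpha).
Proof.
move=> alt x s; rewrite /iota7 (_ : ins _ _ _ = ins ord0 e7 x \o lift_perm ord0 ord0 s).
  by rewrite alt odd_lift_perm addbb.
apply: (@eq_ins _ ord0) => [|m] /=.
  by rewrite lift_perm_id !ins_at.
by rewrite lift_perm_lift !ins_lift.
Qed.

Lemma coordinate7D a (u v : V) : coordinate7 (a *: u + v) = a * coordinate7 u + coordinate7 v.
Proof. by rewrite /coordinate7 !mxE. Qed.

Lemma multilinear_ext7 k (beta : form R k) :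
  is_multilinear beta -> is_multilinear (ext7 beta).
Proof.
move=> ml x i a u v; rewrite /ext7 mulr_sumr -big_split; apply: eq_bigr => j _ /=.
have [m ->|->] := unliftP j i; last first.
  have compE w : upd x j w \o lift j = x \o lift j.
    by apply/funext => m /=; rewrite /upd eq_sym (negbTE (neq_lift _ _)).
  by rewrite !upd_at !compE coordinate7D; ring.
have compE w : upd x (lift j m) w \o lift j = upd (x \o lift j) m w.
  by apply/funext => n /=; rewrite /upd (inj_eq lift_inj).
have atE w : upd x (lift j m) w j = x j by rewrite /upd (negbTE (neq_lift _ _)).
by rewrite !atE !compE ml; ring.
Qed.

Lemma alternating_ext7 k (beta : form R k) :
  is_alternating beta -> is_alternating (ext7 beta).
Proof.
move=> alt x s; rewrite /ext7 mulr_sumr [RHS](reindex_inj (@perm_inj _ s)).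
apply: eq_bigr => j _ /=; have [t st] := perm_lift_decomposition s j.
have -> : (x \o s) \o lift j = (x \o lift (s j)) \o t.
  by apply/funext => m /=; rewrite {1}st lift_perm_lift.
have -> : (-1) ^+ s = (-1) ^+ (j + s j) * (-1) ^+ t :> R.
  by rewrite {1}st odd_lift_perm signr_addb -oddD signr_odd.
rewrite alt exprD; have := sqrr_sign R (s j); rewrite expr2.
move: (_ ^+ s j) (_ ^+ j) (_ ^+ t) => a b c aa.
by rewrite -[LHS]mul1r -aa; ring.
Qed.

Lemma coordinate7_basis i : coordinate7 (basis R i) = (i == inord 6)%:R.
Proof. by rewrite /coordinate7 /basis mxE eqxx andbT eq_sym. Qed.

Lemma val_inord6 : (inord 6 : 'I_7) = 6%N :> nat.
Proof. by rewrite inordK. Qed.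

(** In an increasing list of basis vectors only the last one can be e_7. *)
Lemma form_eq0_last k (alpha : form R k.+1) :
  is_alternating alpha -> is_multilinear alpha ->
  (forall f : 'I_k.+1 -> 'I_7, increasing f ->
    (forall m : 'I_k, (f (lift ord_max m) < 6)%N) -> alpha (basis R \o f) = 0) ->
  forall x, alpha x = 0.
Proof.
move=> alt ml e0; apply: alternating_multilinear_eq0 => // f incf.
apply: e0 => // m; apply: (@leq_trans (f ord_max)); last by rewrite -ltnS ltn_ord.
by apply: incf; rewrite lift_max ltn_ord.
Qed.

Definition vanishes_on_h k (alpha : form R k) : Prop :=
  forall f : 'I_k -> 'I_7, (forall i, (f i < 6)%N) -> alpha (basis R \o f) = 0.

Lemma ext7_last k (beta : form R k) (f : 'I_k.+1 -> 'I_7) :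
  (forall m : 'I_k, (f (lift ord_max m) < 6)%N) ->
  ext7 beta (basis R \o f) =
  (-1) ^+ k * coordinate7 (basis R (f ord_max)) * beta (basis R \o f \o lift ord_max).
Proof.
move=> fh; rewrite /ext7 (bigD1 ord_max) //= big1 ?addr0 // => j jk.
have [m jm|jm] := unliftP ord_max j; last by rewrite jm eqxx in jk.
rewrite jm coordinate7_basis; suff /negbTE -> : f (lift ord_max m) != inord 6.
  by rewrite mulr0 mul0r.
by apply: contraTneq (fh m) => ->; rewrite val_inord6.
Qed.

Lemma basis_e7 (i : 'I_7) : ~~ (i < 6)%N -> i = inord 6.
Proof.
rewrite -leqNgt => i6; apply/val_inj; rewrite /= val_inord6; apply/eqP.
by rewrite eqn_leq i6 andbT -ltnS ltn_ord.
Qed.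

(** By ext7_last, a component of ext7 beta with e_7 in the last place is, up
    to sign, a component of beta on h, and the components of ext7 beta on h
    vanish. *)
Lemma ext7_eq0 k (beta : form R k) :
  is_alternating beta -> is_multilinear beta ->
  (forall x, ext7 beta x = 0) <-> vanishes_on_h beta.
Proof.
move=> alt ml; split=> [e0 f fh|bh].
  pose g : 'I_k.+1 -> 'I_7 := fun m => oapp f (inord 6) (unlift ord_max m).
  have gE m : g (lift ord_max m) = f m by rewrite /g liftK.
  have := e0 (basis R \o g); rewrite ext7_last; last by move=> m; rewrite gE.
  rewrite coordinate7_basis /g unlift_none eqxx mulr1 => /eqP.
  rewrite mulf_eq0 signr_eq0 /= => /eqP <-; congr (beta _).
  by apply/funext => m /=; rewrite liftK.
apply: form_eq0_last; [exact: alternating_ext7|exact: multilinear_ext7|].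
by move=> f _ fh; rewrite ext7_last // (bh (f \o lift ord_max)) ?mulr0.
Qed.

(** Any form alpha is the sum of e^7 /\ iota7 alpha and of a form without e^7,
    which is determined by the values of alpha on h. *)
Lemma ext7_iota7 k (alpha : form R k.+1) :
  is_alternating alpha -> is_multilinear alpha -> vanishes_on_h alpha ->
  forall x, ext7 (iota7 alpha) x = alpha x.
Proof.
move=> alt ml ah x; apply/eqP; rewrite -subr_eq0; apply/eqP.
have altE := alternating_ext7 (alternating_iota7 alt).
have mlE := multilinear_ext7 (multilinear_iota7 ml).
apply: (@form_eq0_last _ (fun x => ext7 (iota7 alpha) x - alpha x)).
- by move=> y s; rewrite altE alt mulrBr.
- by move=> y i a u v; rewrite mlE ml; ring.
move=> f _ fh; rewrite ext7_last // coordinate7_basis.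
case: eqP => [f7|/eqP f7]; last first.
  rewrite mulr0 mul0r ah ?subrr // => i.
  have [m ->|->] := unliftP ord_max i; first exact: fh.
  by apply: contraNT f7 => /basis_e7 ->.
rewrite mulr1 /iota7 (alternating_ins ord0 ord_max _ _ alt) add0n mulrA -expr2 sqrr_sign.
by rewrite mul1r -{2}(ins_id ord_max (basis R \o f)) /= f7 subrr.
Qed.

(** The term of theta B in which B acts on the inserted vector e_7 vanishes. *)
Lemma iota7_theta B k (alpha : form R k.+1) : is_multilinear alpha ->
  B *m e7 = 0 -> theta B (iota7 alpha) = iota7 (theta B alpha).
Proof.
move=> ml Be; apply/funext => x; rewrite /iota7 !thetaE; congr (- _).
rewrite big_ord_recl ins_at Be multilinear0 // add0r; apply: eq_bigr => i _.
by rewrite ins_lift upd_ins_lift.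
Qed.

Lemma vanishes_on_h_theta B k (alpha : form R k) : is_multilinear alpha ->
  (forall m : 'I_7, (m < 6)%N -> B (inord 6) m = 0) ->
  vanishes_on_h alpha -> vanishes_on_h (theta B alpha).
Proof.
move=> ml B6 ah f fh; rewrite thetaE big1 ?oppr0 // => i _.
rewrite mul_basis multilinear_sum // big1 // => n _.
have [n6|/basis_e7 ->] := boolP (n < 6)%N; last by rewrite B6 ?mul0r //; apply: fh.
pose g m := if m == i then n else f m.
rewrite (_ : upd _ _ _ = basis R \o g) ?ah ?mulr0 //.
  by move=> m; rewrite /g; case: eqP.
by apply/funext => m; rewrite /upd /g /=; case: eqP.
Qed.

End Operators.

(** * The differential of an almost Abelian Lie algebra *)

Section Differential.
Variable R : realType.
Local Notation V := 'cV[R]_7.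
Implicit Types (k l : nat) (B : 'M[R]_7).

(** The pair (j, i) stands for two positions removed one after the other,
    first j and then lift j i; lift_swap removes the same two in the opposite
    order. *)
Definition lift_swap k (p : 'I_k.+2 * 'I_k.+1) : 'I_k.+2 * 'I_k.+1 :=
  (lift p.1 p.2, inord (unbump p.2 p.1)).

Lemma unbump_bound k (j : 'I_k.+2) (i : 'I_k.+1) : (unbump i j < k.+1)%N.
Proof. by rewrite /unbump; have := ltn_ord i; have := ltn_ord j; lia. Qed.

Lemma lift_swap_lift k (p : 'I_k.+2 * 'I_k.+1) (q := lift_swap p) :
  lift q.1 q.2 = p.1.
Proof.
apply/val_inj; rewrite /= inordK ?unbump_bound // /bump /unbump.
by case: p {q} => j i /=; lia.
Qed.

Lemma lift_swapK k : involutive (@lift_swap k).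
Proof.
move=> p; rewrite {1}/lift_swap lift_swap_lift; case: p => j i.
congr (_, _); apply/val_inj; rewrite /= !inordK ?unbump_bound //.
all: rewrite /bump /unbump; have := ltn_ord i; case: (leqP j i) => ji; case: ltnP => h; lia.
Qed.

Lemma lift_swap_comp k (p : 'I_k.+2 * 'I_k.+1) (q := lift_swap p) (m : 'I_k) :
  lift q.1 (lift q.2 m) = lift p.1 (lift p.2 m).
Proof.
apply/val_inj; rewrite /= inordK ?unbump_bound // /bump /unbump.
by case: p {q} => j i /=; lia.
Qed.

Lemma upd_lift_swap k (x : 'I_k.+2 -> V) (p : 'I_k.+2 * 'I_k.+1) w
    (q := lift_swap p) :
  upd (x \o lift p.1) p.2 w = upd (x \o lift q.1) q.2 w \o lift_perm p.2 q.2 1.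
Proof.
apply: (@eq_ins _ _ p.2) => [|m] /=.
  by rewrite lift_perm_id !upd_at.
rewrite lift_perm_lift perm1 /upd /=.
rewrite !(eq_sym (lift _ _)) !(negbTE (neq_lift _ _)).
by rewrite -(lift_swap_comp p).
Qed.

(** The bracket has two terms, one for each of the two arguments whose
    coordinate 7 it takes.  Exchanging the two positions in the first of them
    turns a sum over unordered pairs with two terms into a sum over ordered
    pairs with one: x_j is fed to e^7, and ad_e7 A acts on the other argument. *)
Lemma ext_dE (A : 'M[R]_6) k (alpha : form R k.+1) x :
  is_alternating alpha -> is_multilinear alpha ->
  ext_d A alpha x = ext7 (theta (ad_e7 A) alpha) x.
Proof.
move=> alt ml; set B := ad_e7 A.
pose c (v : V) := coordinate7 v.
pose G (p : 'I_k.+2 * 'I_k.+1) (w : V) := alpha (upd (x \o lift p.1) p.2 w).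
have GE (j : 'I_k.+2) (i : 'I_k.+1) (w : V) :
    alpha (fun m => if m == i then w else x (lift j m)) = G (j, i) w by [].
have Glin p a u b v : G p (a *: u - b *: v) = a * G p u - b * G p v.
  by rewrite /G ml -[- (b *: v)]addr0 -scaleNr ml multilinear0 //; ring.
have Gswap p w : G p w = (-1) ^+ (p.2 + (lift_swap p).2) * G (lift_swap p) w.
  by rewrite /G upd_lift_swap alt odd_lift_perm odd_perm1 addbF -oddD signr_odd.
transitivity (\sum_(p : 'I_k.+2 * 'I_k.+1 | (p.2 < p.1)%N) (-1) ^+ p.1 *
   (c (x (lift p.1 p.2)) * G p (B *m x p.1) - c (x p.1) * G p (B *m x (lift p.1 p.2)))).
  rewrite /ext_d pair_big_dep /=; apply: eq_bigr => -[j i] _ /=.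
  by rewrite GE /bracket Glin.
transitivity (\sum_(p : 'I_k.+2 * 'I_k.+1) (-1) ^+ p.1
  * (- (c (x p.1) * G p (B *m x (lift p.1 p.2))))).
  rewrite [RHS](bigID (fun p : 'I_k.+2 * 'I_k.+1 => p.2 < p.1)%N).
  rewrite [X in _ = _ + X](reindex_inj (inv_inj (@lift_swapK k))).
  rewrite [X in _ = _ + X](eq_bigl (fun p : 'I_k.+2 * 'I_k.+1 => p.2 < p.1)%N); last first.
    by move=> [j i] /=; rewrite inordK ?unbump_bound // /bump /unbump; lia.
  rewrite -big_split; apply: eq_bigr => p pp.
  rewrite lift_swap_lift (Gswap p (B *m x p.1)) -/((lift_swap p).1).
  have sgn : (-1) ^+ p.1 * (-1) ^+ (p.2 + (lift_swap p).2) = - (-1) ^+ (lift_swap p).1 :> R.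
    rewrite -exprD -signr_odd -[in RHS]signr_odd.
    have -> : odd (p.1 + (p.2 + (lift_swap p).2)) = ~~ odd (lift_swap p).1.
      by case: p pp => j i /= ij; rewrite inordK ?unbump_bound // /bump /unbump; lia.
    by rewrite signrN.
  move: ((lift_swap p).1) (c (x (lift_swap p).1)) sgn => q1 c2 sgn.
  move: (_ ^+ p.1) (_ ^+ (_ + _)) (_ ^+ q1) (G p _) (G _ _) (c _) sgn => a b d g1 g2 c1 sgn.
  rewrite /= mulrBr; transitivity (a * b * c2 * g2 - a * (c1 * g1)); first by ring.
  by rewrite sgn; ring.
rewrite /ext7 -[LHS](pair_big xpredT xpredT
  (fun j i => (-1) ^+ (nat_of_ord j) * (- (c (x j) * G (j,i) (B *m x (lift j i)))))) /=.
apply: eq_bigr => j _; rewrite thetaE -mulrA -mulr_sumr sumrN; congr (_ * _).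
by rewrite mulrN -mulr_sumr.
Qed.

End Differential.

(** * The Hodge star and derivations *)

Section HodgeStar.
Variable R : realType.
Local Notation V := 'cV[R]_7.
Implicit Types (k l : nat) (B : 'M[R]_7).

(** Transpositions generate the symmetric group. *)
Lemma alternating_tperm k (alpha : form R k) :
  (forall x i j, i != j -> alpha (x \o tperm i j) = - alpha x) ->
  is_alternating alpha.
Proof.
move=> alt x s; have [ts -> dts] := prod_tpermP s.
elim: ts dts x => [|t ts IH] /=.
  by move=> _ x; rewrite big_nil odd_perm1 mul1r; congr alpha; apply/funext => m /=;
    rewrite perm1.
move=> /andP[dt dts] x; rewrite big_cons odd_permM odd_tperm dt.
have -> : x \o (tperm t.1 t.2 * \prod_(u <- ts) tperm u.1 u.2)%g =
          (x \o (\prod_(u <- ts) tperm u.1 u.2)%g) \o tperm t.1 t.2.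
  by apply/funext => m /=; rewrite permM.
by rewrite alt // IH // signr_addb mulN1r mulNr.
Qed.

Definition detf (z : 'I_7 -> V) : R := \det (\matrix_(a < 7, b < 7) z b a 0).

Lemma alternating_detf : is_alternating (detf : form R 7).
Proof.
move=> z s; rewrite /detf -det_tr -[in RHS]det_tr -det_perm -det_mulmx -row_permE.
by congr (\det _); apply/matrixP => a b; rewrite !mxE.
Qed.

Lemma multilinear_detf : is_multilinear (detf : form R 7).
Proof.
move=> z i c u v; rewrite /detf -!(det_tr (\matrix_(_, _) _)).
have -> : \det (\matrix_(a, b) upd z i v b a 0)^T =
  1 * \det (\matrix_(a, b) upd z i v b a 0)^T by rewrite mul1r.
apply: (determinant_multilinear (i0 := i)).
- by apply/rowP => b; rewrite !mxE !upd_at !mxE mul1r.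
- by apply/matrixP => a b; rewrite !mxE /upd eq_sym (negbTE (neq_lift _ _)).
- by apply/matrixP => a b; rewrite !mxE /upd eq_sym (negbTE (neq_lift _ _)).
Qed.

(** With X the matrix of the columns z, expanding along the replaced column b
    gives the entry (b, b) of adj(X) B X; and the trace of B X adj(X) is det X
    times tr B. *)
Lemma detf_trace B z : \sum_b detf (upd z b (B *m z b)) = \tr B * detf z.
Proof.
pose X := \matrix_(a < 7, b < 7) z b a 0.
transitivity (\tr (B *m X *m \adj X)); last first.
  by rewrite -mulmxA mul_mx_adj mul_mx_scalar linearZ /= mulrC.
rewrite mxtrace_mulC /mxtrace; apply: eq_bigr => b _.
rewrite /detf (expand_det_col _ b) [RHS]mxE; apply: eq_bigr => a _.
rewrite !mxE upd_at mulrC; congr (_ * _).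
  congr (_ * \det _); apply/matrixP => i j; rewrite !mxE /upd.
  by rewrite eq_sym (negbTE (neq_lift _ _)).
by rewrite [LHS]mxE; apply: eq_bigr => i _; rewrite !mxE.
Qed.

Lemma sum_ffun_ins k (T : finType) (F : {ffun 'I_k.+1 -> T} -> R) (j : 'I_k.+1) :
  \sum_f F f = \sum_(t : T) \sum_(g : {ffun 'I_k -> T})
    F [ffun m => oapp g t (unlift j m)].
Proof.
rewrite pair_big (reindex (fun p : T * {ffun 'I_k -> T} =>
  [ffun m => oapp p.2 p.1 (unlift j m)])) //=.
exists (fun f : {ffun 'I_k.+1 -> T} => (f j, [ffun m => f (lift j m)])).
  move=> [t g] _ /=; congr (_, _); first by rewrite ffunE unlift_none.
  by apply/ffunP => m; rewrite !ffunE liftK.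
move=> f _; apply/ffunP => m; rewrite ffunE.
by case: (unliftP j m) => [m' ->|->] /=; rewrite ?ffunE.
Qed.

Definition listing k (x : 'I_k -> V) : seq V := [seq x q | q <- enum 'I_k].

Lemma size_listing k (x : 'I_k -> V) : size (listing x) = k.
Proof. by rewrite size_map size_enum_ord. Qed.

Lemma nth_listing k (x : 'I_k -> V) (i : 'I_k) : nth 0 (listing x) i = x i.
Proof. by rewrite (nth_map i) ?size_enum_ord ?ltn_ord // nth_ord_enum. Qed.

(** The list of arguments of the volume form in the definition of the star, as
    a function of the position; slotl and slotr are the positions of its two
    parts. *)
Definition glue k l (y : 'I_k -> V) (x : 'I_l -> V) : 'I_7 -> V :=
  fun b => nth 0 (listing y ++ listing x) b.

Section Glue.
Variables (k l : nat) (e : (k + l = 7)%N).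

Definition slotl (i : 'I_k) : 'I_7 := cast_ord e (lshift l i).
Definition slotr (i : 'I_l) : 'I_7 := cast_ord e (rshift k i).

Lemma glue_l (y : 'I_k -> V) (x : 'I_l -> V) i : glue y x (slotl i) = y i.
Proof. by rewrite /glue nth_cat size_listing /= ltn_ord nth_listing. Qed.

Lemma glue_r (y : 'I_k -> V) (x : 'I_l -> V) i : glue y x (slotr i) = x i.
Proof.
by rewrite /glue nth_cat size_listing /= ltnNge leq_addr /= addKn nth_listing.
Qed.

Lemma slotP (b : 'I_7) : (exists i, b = slotl i) \/ (exists i, b = slotr i).
Proof.
rewrite -[b](cast_ordKV e); case: (split_ordP (cast_ord (esym e) b)) => i ->.
  by left; exists i.
by right; exists i.
Qed.

Lemma slot_lr i j : (slotl i == slotr j) = false.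
Proof. by rewrite (inj_eq (@cast_ord_inj _ _ e)) eq_lrshift. Qed.

Lemma slotl_eq i j : (slotl i == slotl j) = (i == j).
Proof. by rewrite (inj_eq (@cast_ord_inj _ _ e)) eq_lshift. Qed.

Lemma slotr_eq i j : (slotr i == slotr j) = (i == j).
Proof. by rewrite (inj_eq (@cast_ord_inj _ _ e)) eq_rshift. Qed.

Lemma glue_eq (z z' : 'I_7 -> V) :
  (forall i, z (slotl i) = z' (slotl i)) -> (forall i, z (slotr i) = z' (slotr i)) -> z = z'.
Proof. by move=> el er; apply/funext => b; case: (slotP b) => -[i ->]. Qed.

Lemma glue_updl (y : 'I_k -> V) (x : 'I_l -> V) i v :
  glue (upd y i v) x = upd (glue y x) (slotl i) v.
Proof.
by apply: glue_eq => j; rewrite /upd ?glue_l ?glue_r 1?eq_sym ?slot_lr ?slotl_eq //  eq_sym.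
Qed.

Lemma glue_updr (y : 'I_k -> V) (x : 'I_l -> V) i v :
  glue y (upd x i v) = upd (glue y x) (slotr i) v.
Proof.
by apply: glue_eq => j; rewrite /upd ?glue_l ?glue_r ?slot_lr ?slotr_eq.
Qed.

Lemma big_glue (F : 'I_7 -> R) : \sum_b F b = \sum_i F (slotl i) + \sum_i F (slotr i).
Proof.
rewrite (reindex (cast_ord e)) /= ?big_split_ord //.
by exists (cast_ord (esym e)) => b _; rewrite ?cast_ordK ?cast_ordKV.
Qed.

Lemma glue_tperm (y : 'I_k -> V) (x : 'I_l -> V) i j :
  glue (y \o tperm i j) x = glue y x \o tperm (slotl i) (slotl j).
Proof.
apply: glue_eq => m /=; rewrite ?glue_l ?glue_r.
  by rewrite -inj_tperm ?glue_l // => a b /eqP; rewrite slotl_eq => /eqP.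
by rewrite tpermD ?glue_r // slot_lr.
Qed.

Lemma alternating_detf_glue (x : 'I_l -> V) :
  is_alternating ((fun y => detf (glue y x)) : form R k).
Proof.
apply: alternating_tperm => y i j ij.
by rewrite glue_tperm alternating_detf odd_tperm slotl_eq ij expr1 mulN1r.
Qed.

Lemma hodge_detf (alpha : form R k) x :
  @hodge R k l alpha x = (k`!%:R)^-1 *
    \sum_(f : {ffun 'I_k -> 'I_7}) alpha (basis R \o f) * detf (glue (basis R \o f) x).
Proof. by []. Qed.

(** The sum over an orthonormal basis is the inner product of alpha and beta in
    each argument, so that moving B from one factor to the other transposes it. *)
Lemma sum_basis_adjoint B (alpha beta : form R k) (i : 'I_k) :
  is_multilinear alpha -> is_multilinear beta ->
  \sum_(f : {ffun 'I_k -> 'I_7})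
     alpha (upd (basis R \o f) i (B *m basis R (f i))) * beta (basis R \o f) =
  \sum_(f : {ffun 'I_k -> 'I_7})
     alpha (basis R \o f) * beta (upd (basis R \o f) i (B^T *m basis R (f i))).
Proof.
move=> mla mlb.
pose set (f : {ffun 'I_k -> 'I_7}) m : {ffun 'I_k -> 'I_7} :=
  [ffun j => if j == i then m else f j].
have updE (f : {ffun 'I_k -> 'I_7}) m : upd (basis R \o f) i (basis R m) = basis R \o set f m.
  by apply/funext => j; rewrite /upd /= ffunE; case: eqP.
under eq_bigr => f _ do rewrite mul_basis multilinear_sum // mulr_suml.
under [RHS]eq_bigr => f _ do rewrite mul_basis multilinear_sum // mulr_sumr.
rewrite !pair_big /=.
pose h (p : {ffun 'I_k -> 'I_7} * 'I_7) := (set p.1 p.2, p.1 i).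
have hK : involutive h.
  move=> [f m]; rewrite /h /= ffunE eqxx; congr (_, _).
  by apply/ffunP => j; rewrite !ffunE; case: eqP => // ->.
rewrite (reindex_inj (inv_inj hK)); apply: eq_bigr => -[f m] _ /=.
rewrite !updE ffunE eqxx mxE (_ : set (set f m) (f i) = f); first by ring.
by have [] := hK (f, m).
Qed.

(** By detf_trace, letting B^T act on each of the seven arguments of the volume
    form in turn multiplies the volume form by tr B.  Acting on the arguments x,
    it gives minus theta B^T of the star; acting on the basis vectors that are
    summed over, it gives minus the star of theta B alpha, by
    sum_basis_adjoint. *)
Lemma hodge_theta B (alpha : form R k) x : is_multilinear alpha ->
  @hodge R k l (theta B alpha) x =
  - theta B^T (@hodge R k l alpha) x - \tr B * @hodge R k l alpha x.
Proof.
move=> ml; rewrite (thetaE _ (@hodge R k l _)) opprK -mxtrace_tr.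
have -> : \sum_i @hodge R k l alpha (upd x i (B^T *m x i)) = (k`!%:R)^-1 *
    \sum_(f : {ffun 'I_k -> 'I_7}) alpha (basis R \o f) *
      \sum_i detf (glue (basis R \o f) (upd x i (B^T *m x i))).
  rewrite -mulr_sumr exchange_big; congr (_ * _); apply: eq_bigr => f _ /=.
  by rewrite mulr_sumr.
rewrite !hodge_detf mulrCA -mulrBr; congr (_ * _); rewrite mulr_sumr -sumrB.
transitivity (- \sum_(f : {ffun 'I_k -> 'I_7}) alpha (basis R \o f) *
     \sum_i detf (glue (upd (basis R \o f) i (B^T *m basis R (f i))) x)); last first.
  rewrite -sumrN; apply: eq_bigr => f _; rewrite mulrCA -detf_trace big_glue.
  under [X in _ = _ - _ * (X + _)]eq_bigr => i _ do rewrite -glue_updl glue_l.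
  under [X in _ = _ - _ * (_ + X)]eq_bigr => i _ do rewrite -glue_updr glue_r.
  by rewrite mulrDr opprD addrC subrK.
under eq_bigr => f _ do rewrite thetaE mulNr mulr_suml.
under [X in _ = - X]eq_bigr => f _ do rewrite mulr_sumr.
rewrite sumrN exchange_big /= [X in _ = - X]exchange_big; congr (- _).
apply: eq_bigr => i _; apply: (sum_basis_adjoint _ _ ml (beta := fun y => detf (glue y x))).
by move=> y j a u v; rewrite !glue_updl multilinear_detf.
Qed.

End Glue.
End HodgeStar.

(** * The Hodge star and exterior multiplication by e^7 *)

Section HodgeExterior.
Variable R : realType.
Local Notation V := 'cV[R]_7.
Implicit Types (k l : nat) (B : 'M[R]_7).

(** Moving a vector from the first group of arguments to the head of the
    second one. *)
Lemma glue_ins k l (e : (k.+1 + l = 7)%N) (e' : (k + l.+1 = 7)%N)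
    (j : 'I_k.+1) v (y : 'I_k -> V) (x : 'I_l -> V) :
  glue (ins j v y) x =
  glue y (ins ord0 v x) \o lift_perm (slotl e j) (slotr e' ord0) 1.
Proof.
apply: (@eq_ins _ _ (slotl e j)) => [|m] /=.
  by rewrite lift_perm_id (glue_l e) (glue_r e') !ins_at.
rewrite lift_perm_lift perm1; have := ltn_ord m; have := ltn_ord j.
have [mk|km] := ltnP m k => jk m6.
  have -> : lift (slotl e j) m = slotl e (lift j (Ordinal mk)) by apply/val_inj.
  have -> : lift (slotr e' ord0) m = slotl e' (Ordinal mk).
    by apply/val_inj; rewrite /= /bump addn0 leqNgt mk.
  by rewrite !glue_l ins_lift.
have ml : (m - k < l)%N by lia.
have -> : lift (slotl e j) m = slotr e (Ordinal ml).
  by apply/val_inj; rewrite /= /bump (leq_trans _ km) // addSn subnKC.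
have -> : lift (slotr e' ord0) m = slotr e' (lift ord0 (Ordinal ml)).
  by apply/val_inj; rewrite /= /bump addn0 km /= addnCA subnKC.
by rewrite !glue_r ins_lift.
Qed.

(** In the sum over the basis, the argument that e^7 receives must be e_7.
    Moving it from position j to the head of the other arguments gives the
    sign (-1)^(k - j), so that together with the sign (-1)^j of ext7 all k + 1
    positions contribute the same value; their number makes up for the change
    of the factorial. *)
Lemma hodge_ext7 k l (beta : form R k) x : (k + l.+1 = 7)%N ->
  @hodge R k.+1 l (ext7 beta) x = (-1) ^+ k * iota7 (@hodge R k l.+1 beta) x.
Proof.
move=> e'; have e : (k.+1 + l = 7)%N by rewrite addSnnS.
rewrite hodge_detf.
have sumE (j : 'I_k.+1) : \sum_(f : {ffun 'I_k.+1 -> 'I_7})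
     (-1) ^+ j * coordinate7 (basis R (f j)) * beta (basis R \o f \o lift j)
       * detf (glue (basis R \o f) x) =
   (-1) ^+ k * (k`!%:R * iota7 (@hodge R k l.+1 beta) x).
  rewrite (sum_ffun_ins _ j) (bigD1 (inord 6)) //= [X in _ + X]big1 ?addr0; last first.
    move=> t /negbTE t7; apply: big1 => g _.
    by rewrite ffunE unlift_none /= coordinate7_basis t7 mulr0 !mul0r.
  rewrite /iota7 hodge_detf mulVKf; last by rewrite pnatr_eq0 -lt0n fact_gt0.
  rewrite mulr_sumr; apply: eq_bigr => g _.
  rewrite ffunE unlift_none /= coordinate7_basis eqxx mulr1.
  have -> : basis R \o [ffun m => oapp g (inord 6) (unlift j m)] =
            ins j (e7 R) (basis R \o g).
    apply/funext => m; rewrite /= ffunE /ins; by case: unlift.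
  rewrite ins_lift_comp (glue_ins e e') alternating_detf odd_lift_perm odd_perm1.
  rewrite addbF -oddD signr_odd /= addn0 exprD.
  have := sqrr_sign R j; rewrite expr2.
  move: (_ ^+ j) (_ ^+ k) (beta _) (detf _) => a b c d aa.
  by rewrite -[RHS]mul1r -aa; ring.
transitivity ((k.+1)`!%:R^-1 * \sum_(j < k.+1)
  ((-1) ^+ k * (k`!%:R * iota7 (@hodge R k l.+1 beta) x))).
  congr (_ * _); rewrite -(eq_bigr _ (fun j _ => sumE j)).
  by rewrite exchange_big; apply: eq_bigr => f _; rewrite /ext7 mulr_suml.
rewrite sumr_const card_ord -[X in _ * X]mulr_natl factS natrM.
have a0 : k.+1%:R != 0 :> R by rewrite pnatr_eq0.
have b0 : k`!%:R != 0 :> R by rewrite pnatr_eq0 -lt0n fact_gt0.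
move: (k.+1%:R) (k`!%:R) a0 b0 (_ ^+ k) (iota7 _ _) => a b a0 b0 c d.
by field; rewrite a0 b0.
Qed.

End HodgeExterior.

(** * The Hodge star of a coordinate form *)

Section CoordinateForms.
Variable R : realType.
Local Notation V := 'cV[R]_7.

(** Let P be the permutation matrix that sends column b to the row I b or K b.
    The matrix on the left is the product of P with a block triangular matrix
    whose upper left block is the identity. *)
Lemma det_coordinates k l (I : 'I_k -> 'I_(k + l)) (K : 'I_l -> 'I_(k + l))
    (X : 'M[R]_(k + l, l)) :
  injective (fun b : 'I_(k + l) => match fintype.split b with inl i => I i | inr j =>
    K j end) ->
  \det (\matrix_(a, b) match fintype.split b with inl i => (a == I i)%:R | inr j => X a j end) =
  \det (\matrix_(a, b) (a == match fintype.split b with inl i => I i | inr j => K j end)%:R)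
  * \det (\matrix_(i, j) X (K i) j).
Proof.
set g := (fun b : 'I_(k + l) => match fintype.split b with inl i => I i | inr j =>
  K j end) => injg.
have -> : \det (\matrix_(i, j) X (K i) j) =
   \det (block_mx (1%:M : 'M[R]_k) (\matrix_(i, j) X (I i) j) 0 (\matrix_(i, j) X (K i) j)).
  by rewrite det_ublock det1 mul1r.
rewrite -det_mulmx; congr (\det _); apply/matrixP => a b; rewrite !mxE.
have [c ga] : exists c, g c = a by have [h _ hK] := injF_bij injg; exists (h a).
rewrite (bigD1 c) //= big1 ?addr0 => [|d dc]; last first.
  rewrite mxE -/(g d) -ga (inj_eq injg) eq_sym (negbTE dc) mul0r //.
rewrite mxE -/(g c) ga eqxx mul1r.
have gL i : g (lshift l i) = I i by rewrite /g (unsplitK (inl i)).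
have gR j : g (rshift k j) = K j by rewrite /g (unsplitK (inr j)).
case: (split_ordP c) ga => i -> <-; case: (split_ordP b) => j ->;
 rewrite ?gL ?gR ?(block_mxEul, block_mxEur, block_mxEdl, block_mxEdr) !mxE
   ?(unsplitK (inl _)) ?(unsplitK (inr _)) //.
  by rewrite -!gL (inj_eq injg) eq_lshift.
by rewrite -gL -gR (inj_eq injg) eq_rlshift.
Qed.

(** Here the size n is only provably equal to k + l, as in the definition of
    the star, whose degrees satisfy k + l = 7. *)
Lemma det_coordinates_cast k l n (e : (k + l = n)%N) (g : 'I_n -> 'I_n) (X : 'M[R]_(n, l)) :
  injective g ->
  \det (\matrix_(a, b) match fintype.split (cast_ord (esym e) b) with
                       | inl i => (a == g (cast_ord e (lshift l i)))%:R
                       | inr j => X a j end) =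
  \det (\matrix_(a, b) (a == g b)%:R) *
  \det (\matrix_(i, j) X (g (cast_ord e (rshift k i))) j).
Proof.
case: n / e g X => g X injg.
pose I i := g (lshift l i); pose K j := g (rshift k j).
have gE b : (match fintype.split b with inl i => I i | inr j => K j end) = g b.
  by case: (split_ordP b) => i ->; rewrite ?(unsplitK (inl _)) ?(unsplitK (inr _)).
have := @det_coordinates k l I K X.
under eq_fun => b do rewrite gE.
move=> /(_ injg) E; move: E.
have -> : \matrix_(a, b) (a == match fintype.split b with inl i => I i | inr j =>
  K j end)%:R = \matrix_(a, b) (a == g b)%:R :> 'M[R]_(k + l).
  by apply/matrixP => a b; rewrite !mxE gE.
have cE b : cast_ord (erefl (k + l)%N) b = b by apply/val_inj.
move=> E; transitivity (\det (\matrix_(a, b) match fintype.split b with inl i =>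
  (a == I i)%:R | inr j => X a j end)).
  by congr (\det _); apply/matrixP => a b; rewrite !mxE cE; case: fintype.split => i //;
    rewrite cE.
by rewrite E; congr (_ * \det _); apply/matrixP => i j; rewrite !mxE cE.
Qed.

(** The parity of a list that enumerates 0, ..., n - 1, by expansion of the
    permutation matrix along its first column.  It reduces by computation. *)
Fixpoint seq_odd n (s : seq nat) : bool :=
  if n isn't n'.+1 then false else
  if s isn't i :: s' then false else
  odd i (+) seq_odd n' (map (unbump i) s').

Lemma det_seq n (s : seq nat) : size s = n -> uniq s -> all (gtn n) s ->
  \det (\matrix_(a < n, b < n) (nat_of_ord a == nth 0%N s b)%:R) =
    (-1) ^+ seq_odd n s :> R.
Proof.
elim: n s => [|n IH] [|i s] //=; first by rewrite det_mx00.
move=> [sz] /andP[nis us] /andP[lti lts].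
have unbumpK_s a : a \in s -> bump i (unbump i a) = a.
  by move=> sa; rewrite unbumpK // inE; apply: contraNneq nis => <-.
rewrite (expand_det_col _ ord0) (bigD1 (Ordinal lti)) //= big1 ?addr0 => [|a ai].
  rewrite mxE eqxx mul1r /cofactor addn0 signr_addb signr_odd; congr (_ * _).
  rewrite -IH ?size_map //; first last.
  - apply/allP => _ /mapP[a sa ->]; move/allP: lts => /(_ _ sa) /=.
    by move: lti (unbumpK_s _ sa); rewrite /bump /unbump /=; lia.
  - by rewrite map_inj_in_uniq // => a b sa sb ab; rewrite -(unbumpK_s a) // ab unbumpK_s.
  congr (\det _); apply/matrixP => a b; rewrite !mxE /=; congr (_%:R).
  rewrite (nth_map 0%N) ?sz // add0n.
  have sb : nth 0%N s b \in s by rewrite mem_nth // sz.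
  by rewrite -{1}(unbumpK_s _ sb) (inj_eq (can_inj (bumpK i))).
rewrite mxE /= (_ : (_ == _) = false) ?mul0r //.
by apply: contraNF ai => /eqP e; apply/eqP/val_inj.
Qed.

Definition label (I : seq nat) (b : nat) : 'I_7 := inord (nth 0%N I b).-1.

(** The form dx I with the degree as a parameter instead of the length of I,
    so that forms given by different lists of equal length have the same type. *)
Definition dxk k (I : seq nat) : form R k := fun x =>
  \det (\matrix_(a < k, b < k) x a (label I b) 0).

Lemma dxk_basis k I (f : {ffun 'I_k -> 'I_7}) :
  dxk I (basis R \o f) =
  \sum_(s : 'S_k) (-1) ^+ s * (f == [ffun a => label I (s a)])%:R.
Proof.
apply: eq_bigr => s _; congr (_ * _).
case: eqP => [->|ne].
  by apply: big1 => a _; rewrite !mxE ffunE !eqxx.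
have [a fa] : exists a, f a != label I (s a).
  apply/existsP; rewrite -negb_forall; apply/negP => /forallP h.
  by apply: ne; apply/ffunP => a; rewrite ffunE; apply/eqP.
by rewrite (bigD1 a) //= !mxE eqxx andbT eq_sym (negbTE fa) mul0r.
Qed.

(** Each of the k! orderings of I contributes the same value. *)
Lemma hodge_dxk_vol k l (e : (k + l = 7)%N) I (x : 'I_l -> V) :
  @hodge R k l (dxk I) x = detf (glue (fun b : 'I_k => basis R (label I b)) x).
Proof.
rewrite hodge_detf; under eq_bigr => f _ do rewrite dxk_basis mulr_suml.
rewrite exchange_big /=.
transitivity ((k`!%:R)^-1 * \sum_(s : 'S_k) detf
  (glue (fun b : 'I_k => basis R (label I b)) x)); last first.
  by rewrite sumr_const card_Sn -[X in _ * X]mulr_natl mulKf // pnatr_eq0 -lt0n fact_gt0.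
congr (_ * _); apply: eq_bigr => s _.
rewrite (bigD1 [ffun a => label I (s a)]) //= big1 ?addr0 => [|f /negbTE ->]; last first.
  by rewrite mulr0 mul0r.
rewrite eqxx mulr1.
have -> : basis R \o [ffun a => label I (s a)] = (fun b : 'I_k => basis R (label I b)) \o s.
  by apply/funext => a /=; rewrite ffunE.
by rewrite (alternating_detf_glue e x) mulrA -expr2 sqrr_sign mul1r.
Qed.

(** The star evaluates the volume form at the basis vectors with labels in I
    followed by x; by det_coordinates this is, up to the sign of the list I ++
    K, the minor of x in the rows with labels in K. *)
Lemma hodge_dxk k l I K (x : 'I_l -> V) :
  (k + l = 7)%N -> size I = k -> size K = l -> perm_eq (I ++ K) (iota 1 7) ->
  @hodge R k l (dxk I) x =
  (-1) ^+ seq_odd 7 (map predn (I ++ K)) * dxk K x.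
Proof.
move=> e sI sK pIK; rewrite (hodge_dxk_vol e).
have sIK : size (map predn (I ++ K)) = 7 by rewrite size_map size_cat sI sK.
have pIK' : perm_eq (map predn (I ++ K)) (iota 0 7) by rewrite (perm_map predn pIK).
have uIK : uniq (map predn (I ++ K)) by rewrite (perm_uniq pIK').
have aIK : all (gtn 7) (map predn (I ++ K)) by rewrite (perm_all _ pIK').
rewrite -det_seq //.
pose g (b : 'I_7) : 'I_7 := inord (nth 0%N (map predn (I ++ K)) b).
have gE (b : 'I_7) : g b = nth 0%N (map predn (I ++ K)) b :> nat.
  by rewrite /g inordK //; apply: (allP aIK); rewrite mem_nth ?sIK.
have injg : injective g.
  move=> a b /(congr1 val); rewrite /= !gE => /eqP.
  by rewrite nth_uniq ?sIK // => /eqP/val_inj.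
have sIK0 : size (I ++ K) = 7 by rewrite size_cat sI sK.
have gL i : g (slotl e i) = label I i.
  rewrite /g /label (nth_map 0%N) ?sIK0 // nth_cat sI.
  have -> : nat_of_ord (slotl e i) = i by [].
  by rewrite ltn_ord.
have gR i : g (slotr e i) = label K i.
  rewrite /g /label (nth_map 0%N) ?sIK0 // nth_cat sI.
  have -> : nat_of_ord (slotr e i) = (k + i)%N by [].
  by rewrite ltnNge leq_addr addKn.
have := @det_coordinates_cast k l 7 e g (\matrix_(a, j) x j a 0) injg.
rewrite /detf => detE; transitivity
  (\det (\matrix_(a, b) match fintype.split (cast_ord (esym e) b) with
  | inl i => (a == g (slotl e i))%:R | inr j => (\matrix_(a, j) x j a 0) a j end)).
  congr (\det _); apply/matrixP => a b; rewrite !mxE.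
  case: (slotP e b) => -[i ->]; rewrite ?glue_l ?glue_r /slotl /slotr cast_ordK.
    by rewrite (unsplitK (inl i)) -gL mxE eqxx andbT.
  by rewrite (unsplitK (inr i)) mxE.
rewrite detE; congr (_ * _).
  by congr (\det _); apply/matrixP => a b; rewrite !mxE -gE.
by rewrite /dxk -[RHS]det_tr; congr (\det _); apply/matrixP => a b;
  rewrite !mxE -[cast_ord _ _]/(slotr e a) gR.
Qed.

Lemma alternating_dxk k I : is_alternating (dxk I : form R k).
Proof.
move=> x s; rewrite /dxk -det_perm -det_mulmx -row_permE.
by congr (\det _); apply/matrixP => a b; rewrite !mxE.
Qed.

Lemma multilinear_dxk k I : is_multilinear (dxk I : form R k).
Proof.
move=> x i c u v; rewrite /dxk.
rewrite -[X in _ = _ + X]mul1r; apply: (determinant_multilinear (i0 := i)).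
- by apply/rowP => b; rewrite !mxE !upd_at !mxE mul1r.
- by apply/matrixP => a b; rewrite !mxE /upd eq_sym (negbTE (neq_lift _ _)).
- by apply/matrixP => a b; rewrite !mxE /upd eq_sym (negbTE (neq_lift _ _)).
Qed.

Lemma hodge_sum_dxk k l (T : seq (bool * (seq nat * seq nat)))
  (pr : (seq nat * seq nat) -> seq nat) x :
  @hodge R k l (fun y => \sum_(t <- T) (-1) ^+ t.1 * dxk (pr t.2) y) x =
  \sum_(t <- T) (-1) ^+ t.1 * @hodge R k l (dxk (pr t.2)) x.
Proof.
rewrite hodge_detf.
under eq_bigr => f _ do rewrite mulr_suml.
rewrite exchange_big mulr_sumr; apply: eq_bigr => t _.
by rewrite hodge_detf [RHS]mulrCA [in RHS]mulr_sumr; congr (_ * _); apply: eq_bigr => f _;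
  rewrite mulrA.
Qed.

Lemma dx_dxk I x : @dx R I x = dxk I x.
Proof. by []. Qed.

Definition coordn (v : V) (n : nat) : R := v (inord n) 0.

Lemma dxk1 I (x : 'I_1 -> V) : dxk I x = coordn (x 0) (nth 0%N I 0).-1.
Proof. by rewrite /dxk det_mx11 mxE. Qed.

Lemma dxkS k (i : nat) I (x : 'I_k.+1 -> V) :
  dxk (i :: I) x = \sum_(a < k.+1) (-1) ^+ a * coordn (x a) i.-1 * dxk I (x \o lift a).
Proof.
rewrite /dxk (expand_det_col _ ord0); apply: eq_bigr => a _.
rewrite !mxE /cofactor addn0 mulrA [_ * (-1) ^+ _]mulrC; congr (_ * \det _).
by apply/matrixP => b c; rewrite !mxE /= /label /= add0n.
Qed.

Definition arg k (s : seq V) : 'I_k -> V := fun m => nth 0 s m.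

Lemma argE k (x : 'I_k -> V) : x = arg (listing x).
Proof. by apply/funext => m; rewrite /arg nth_listing. Qed.

(** Minors of vectors that are given by their coordinate functions.  As in dx,
    labels are counted from 1, coordinates from 0. *)
Definition det2 (u v : nat -> R) (i j : nat) : R := u i.-1 * v j.-1 - v i.-1 * u j.-1.
Definition det3 (u v w : nat -> R) (i j k : nat) : R :=
  u i.-1 * det2 v w j k - v i.-1 * det2 u w j k + w i.-1 * det2 u v j k.
Definition det4 (u v w z : nat -> R) (i j k l : nat) : R :=
  u i.-1 * det3 v w z j k l - v i.-1 * det3 u w z j k l
  + w i.-1 * det3 u v z j k l - z i.-1 * det3 u v w j k l.

Lemma dxk2 i j u v : dxk [:: i; j] (@arg 2 [:: u; v]) = det2 (coordn u) (coordn v) i j.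
Proof.
by rewrite dxkS !big_ord_recl big_ord0 !dxk1 /arg /bump /= /det2 /=; ring.
Qed.

Lemma dxk3 i j k u v w :
  dxk [:: i; j; k] (@arg 3 [:: u; v; w]) = det3 (coordn u) (coordn v) (coordn w) i j k.
Proof.
rewrite !dxkS !big_ord_recl !big_ord0 !dxkS !big_ord_recl !big_ord0.
by rewrite !dxk1 /arg /bump /= /det3 /det2 /=; ring.
Qed.

Lemma dxk4 i j k l u v w z :
  dxk [:: i; j; k; l] (@arg 4 [:: u; v; w; z]) =
  det4 (coordn u) (coordn v) (coordn w) (coordn z) i j k l.
Proof.
rewrite dxkS !big_ord_recl big_ord0.
have e (a : 'I_4) (s : seq V) :
  (forall m : 'I_3, nth 0 [:: u; v; w; z] (bump a m) = nth 0 s m) ->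
    @arg 4 [:: u; v; w; z] \o lift a = @arg 3 s.
  by move=> E; apply/funext => m; apply: E.
have -> : @arg 4 [:: u; v; w; z] \o lift ord0 = @arg 3 [:: v; w; z] by apply: e.
have -> : @arg 4 [:: u; v; w; z] \o lift (lift ord0 ord0) = @arg 3 [:: u; w; z].
  by apply: e; case=> [[|[|[|]]]].
have -> : @arg 4 [:: u; v; w; z] \o lift (lift ord0 (lift ord0 ord0)) = @arg 3 [:: u; v; z].
  by apply: e; case=> [[|[|[|]]]].
have -> : @arg 4 [:: u; v; w; z] \o lift (lift ord0 (lift ord0 (lift ord0 ord0))) =
  @arg 3 [:: u; v; w].
  by apply: e; case=> [[|[|[|]]]].
by rewrite !dxk3 /arg /bump /= /det4; ring.
Qed.

Lemma alternating_sum_dxk k (T : seq (bool * (seq nat * seq nat)))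
  (pr : (seq nat * seq nat) -> seq nat) :
  is_alternating ((fun y => \sum_(t <- T) (-1) ^+ t.1 * dxk (pr t.2) y) : form R k).
Proof.
move=> x s /=; rewrite mulr_sumr; apply: eq_bigr => t _.
by rewrite alternating_dxk mulrCA.
Qed.

Lemma multilinear_sum_dxk k (T : seq (bool * (seq nat * seq nat)))
  (pr : (seq nat * seq nat) -> seq nat) :
  is_multilinear ((fun y => \sum_(t <- T) (-1) ^+ t.1 * dxk (pr t.2) y) : form R k).
Proof.
move=> x i a u v /=; rewrite mulr_sumr -big_split; apply: eq_bigr => t _ /=.
by rewrite multilinear_dxk mulrDr mulrCA.
Qed.

Lemma arg3E (x : 'I_3 -> V) : exists u v w, x = @arg 3 [:: u; v; w].
Proof.
exists (x ord0), (x (lift ord0 ord0)), (x (lift ord0 (lift ord0 ord0))).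
by rewrite [LHS]argE /listing /= !enum_ordSl enum_ord0.
Qed.

End CoordinateForms.

(** * The forms phi and psi *)

Section G2Forms.
Variable R : realType.
Local Notation V := 'cV[R]_7.
Local Notation phi := (@Defs.phi R).
Local Notation psi := (@Defs.psi R).

(** Each entry lists a triple I of phi with its sign, and the complementary
    quadruple K, ordered so that I ++ K is an even permutation. *)
Definition G2_table : seq (bool * (seq nat * seq nat)) :=
  [:: (false, ([:: 1; 2; 7], [:: 3; 4; 5; 6]));
      (false, ([:: 3; 4; 7], [:: 1; 2; 5; 6]));
      (false, ([:: 5; 6; 7], [:: 1; 2; 3; 4]));
      (false, ([:: 1; 3; 5], [:: 4; 2; 6; 7]));
      (true,  ([:: 1; 4; 6], [:: 3; 2; 5; 7]));
      (true,  ([:: 2; 4; 5], [:: 3; 1; 6; 7]));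
      (true,  ([:: 2; 3; 6], [:: 4; 1; 5; 7]))]%N.

(** A permutation of three positions consists of a position for e^7 and a
    permutation s of the other two.  Since alpha is alternating, both choices
    of s give the same term, which cancels the factor 1/2. *)
Lemma wedge_dx7 (alpha : form R 2) (x : 'I_3 -> V) : is_alternating alpha ->
  wedge alpha (@dx R [:: 7]%N) x = ext7 alpha x.
Proof.
move=> alt; rewrite /wedge.
pose h (p : 'I_3 * 'S_2) : 'S_3 := lift_perm ord_max p.1 p.2.
have injh : injective h.
  move=> [j s] [j' s'] /= e; have e0 := congr1 (fun u : 'S_3 => u ord_max) e.
  move: e0; rewrite /h !lift_perm_id /= => jj; subst j'; congr (_, _).
  apply/permP => m; have := congr1 (fun u : 'S_3 => u (lift ord_max m)) e.
  by rewrite /h !lift_perm_lift => /lift_inj.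
have bijh : bijective h.
  by apply: (inj_card_bij injh); rewrite card_prod card_ord !card_Sn.
rewrite (reindex h) /=; last exact: onW_bij.
rewrite -(pair_big xpredT xpredT
  (fun j s => (-1) ^+ h (j, s) * alpha (fun i : 'I_2 => x (h (j, s) (@lshift 2 1 i)))
  * @dx R [:: 7]%N (fun i : 'I_1 => x (h (j, s) (@rshift 2 1 i))))) /=.
have termE (j : 'I_3) (s : 'S_2) :
   (-1) ^+ h (j, s) * alpha (fun i : 'I_2 => x (h (j, s) (@lshift 2 1 i)))
     * @dx R [:: 7]%N (fun i : 'I_1 => x (h (j, s) (@rshift 2 1 i)))
   = (-1) ^+ j * coordinate7 (x j) * alpha (x \o lift j).
  have -> : (fun i : 'I_2 => x (h (j, s) (@lshift 2 1 i))) = (x \o lift j) \o s.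
    apply/funext => i /=; have -> : @lshift 2 1 i = lift ord_max i by apply/val_inj;
      rewrite /= /bump leqNgt ltn_ord.
    by rewrite /h lift_perm_lift.
  have -> : @dx R [:: 7]%N (fun i : 'I_1 => x (h (j, s) (@rshift 2 1 i))) = coordinate7 (x j).
    rewrite /dx det_mx11 mxE /=.
    have -> : @rshift 2 1 0 = ord_max by apply/val_inj.
    by rewrite /h lift_perm_id.
  have -> : (-1) ^+ h (j, s) = (-1) ^+ j * (-1) ^+ s :> R.
    by rewrite /h odd_lift_perm signr_addb -oddD signr_odd exprD -(signr_odd _ 2) mul1r.
  have := sqrr_sign R s; rewrite alt expr2; move: (_ ^+ s) => a aa.
  move: (_ ^+ j) (coordinate7 _) (alpha _) => b c d.
  by rewrite -[RHS]mul1r -aa; ring.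
under eq_bigr => j _ do under eq_bigr => s _ do rewrite termE.
rewrite /ext7 mulr_sumr; apply: eq_bigr => j _.
rewrite sumr_const card_Sn (_ : 2`! = 2)%N // (_ : 1`! = 1)%N // mulr2n.
by move: (_ * _ * alpha _) => c; field.
Qed.

Lemma omegaE u v : omega (R := R) (@arg R 2 [:: u; v]) =
  det2 (coordn u) (coordn v) 1 2 + det2 (coordn u) (coordn v) 3 4
    + det2 (coordn u) (coordn v) 5 6.
Proof. by rewrite /omega /= !dx_dxk !dxk2. Qed.

Lemma alternating_omega : is_alternating (omega (R := R)).
Proof.
by move=> x s; rewrite /omega /= !dx_dxk !(alternating_dxk _ x s) !mulrDr.
Qed.

Lemma phiE : phi = fun x => \sum_(t <- G2_table) (-1) ^+ t.1 * dxk t.2.1 x.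
Proof.
apply/funext => x; rewrite /phi /= wedge_dx7; last exact: alternating_omega.
have [u [v [w ->]]] := arg3E x.
rewrite /ext7 /G2_table !big_cons big_nil !big_ord_recl big_ord0 /rho_plus /omega /= !dx_dxk.
rewrite !dxk3 !dxkS !big_ord_recl !big_ord0 !dxk1 /arg /bump /=
  -![coordinate7 _]/(coordn _ 6) /det3 /det2 /=.
by ring.
Qed.

Definition psi_sum : form R 4 := fun x => \sum_(t <- G2_table) (-1) ^+ t.1 * dxk t.2.2 x.

Lemma G2_table_complementary t : t \in G2_table ->
  [/\ size t.2.1 = 3, size t.2.2 = 4,
      perm_eq (t.2.1 ++ t.2.2) (iota 1 7), seq_odd 7 (map predn (t.2.1 ++ t.2.2)) = false &
      perm_eq (t.2.2 ++ t.2.1) (iota 1 7) /\ seq_odd 7 (map predn (t.2.2 ++ t.2.1)) = false].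
Proof.
have : all (fun t => [&& size t.2.1 == 3, size t.2.2 == 4,
    perm_eq (t.2.1 ++ t.2.2) (iota 1 7), ~~ seq_odd 7 (map predn (t.2.1 ++ t.2.2)),
    perm_eq (t.2.2 ++ t.2.1) (iota 1 7) & ~~ seq_odd 7 (map predn (t.2.2 ++ t.2.1))])%N
      G2_table.
  by vm_compute.
by move=> /allP h /h /and5P[/eqP ? /eqP ? ? /negbTE ? /andP[? /negbTE ?]]; split.
Qed.

Lemma psiE : psi = psi_sum.
Proof.
apply/funext => x; rewrite /psi phiE /psi_sum (hodge_sum_dxk _ G2_table (fun p => p.1)).
apply: eq_big_seq => t /G2_table_complementary[sI sK pIK oIK _].
by rewrite (hodge_dxk (K := t.2.2)) // oIK mul1r.
Qed.

(** Passing from I ++ K to K ++ I moves three entries past four, which is an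
    even permutation; so the table of phi also serves for the star of psi. *)
Lemma hodge_psi : @hodge R 4 3 psi = phi.
Proof.
apply/funext => x; rewrite psiE phiE /psi_sum (hodge_sum_dxk _ G2_table (fun p => p.2)).
apply: eq_big_seq => t /G2_table_complementary[sI sK _ _ [pKI oKI]].
by rewrite (hodge_dxk (K := t.2.1)) // oKI mul1r.
Qed.

Lemma alternating_phi : is_alternating phi.
Proof. rewrite phiE; exact: (alternating_sum_dxk G2_table (fun p => p.1)). Qed.
Lemma multilinear_phi : is_multilinear phi.
Proof. rewrite phiE; exact: (multilinear_sum_dxk G2_table (fun p => p.1)). Qed.
Lemma alternating_psi : is_alternating psi.
Proof. rewrite psiE; exact: (alternating_sum_dxk G2_table (fun p => p.2)). Qed.
Lemma multilinear_psi : is_multilinear psi.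
Proof. rewrite psiE; exact: (multilinear_sum_dxk G2_table (fun p => p.2)). Qed.

End G2Forms.

(** * The Hodge Laplacian of psi *)

Section Laplacian.
Variable R : realType.
Local Notation V := 'cV[R]_7.
Local Notation phi := (@Defs.phi R).
Local Notation psi := (@Defs.psi R).
Implicit Types (k l : nat).

Lemma inord6_rshift : inord 6 = @rshift 6 1 ord0 :> 'I_7.
Proof. by apply/val_inj; rewrite /= inordK. Qed.

Lemma ad_e7_h (A : 'M[R]_6) (i j : 'I_6) : ad_e7 A (lshift 1 i) (lshift 1 j) = A i j.
Proof. exact: (@block_mxEul R 6 1 6 1). Qed.

Lemma ad_e7_col (A : 'M[R]_6) i : ad_e7 A i (inord 6) = 0.
Proof.
rewrite inord6_rshift; case: (@split_ordP 6 1 i) => n ->.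
  by apply: (etrans (@block_mxEur R 6 1 6 1 A 0 0 0 n ord0)); rewrite mxE.
by apply: (etrans (@block_mxEdr R 6 1 6 1 A 0 0 0 n ord0)); rewrite mxE.
Qed.

Lemma ad_e7_row (A : 'M[R]_6) i : ad_e7 A (inord 6) i = 0.
Proof.
rewrite inord6_rshift; case: (@split_ordP 6 1 i) => n ->.
  by apply: (etrans (@block_mxEdl R 6 1 6 1 A 0 0 0 ord0 n)); rewrite mxE.
by apply: (etrans (@block_mxEdr R 6 1 6 1 A 0 0 0 ord0 n)); rewrite mxE.
Qed.

Lemma ad_e7_e7 (A : 'M[R]_6) : ad_e7 A *m e7 R = 0.
Proof.
by rewrite mul_basis big1 // => i _; rewrite ad_e7_col scale0r.
Qed.

Lemma ad_e7_tr (A : 'M[R]_6) : (ad_e7 A)^T = ad_e7 A^T.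
Proof. by apply: (etrans (@tr_block_mx R 6 1 6 1 A 0 0 0)); rewrite !trmx0. Qed.

Lemma ad_e7_trace (A : 'M[R]_6) : \tr (ad_e7 A) = \tr A.
Proof. by apply: (etrans (@mxtrace_block R 6 1 A 0 0 0)); rewrite mxtrace0 addr0. Qed.

Lemma ad_e7D (A M : 'M[R]_6) : ad_e7 (A + M) = ad_e7 A + ad_e7 M.
Proof. by symmetry; apply: (etrans (@add_block_mx R 6 1 6 1 A 0 0 0 M 0 0 0));
  rewrite !addr0. Qed.

Lemma ad_e7Z x (A : 'M[R]_6) : ad_e7 (x *: A) = x *: ad_e7 A.
Proof. by symmetry; apply: (etrans (@scale_block_mx R 6 1 6 1 x A 0 0 0));
  rewrite !scaler0. Qed.

Lemma ad_e7B (A M : 'M[R]_6) : ad_e7 (A - M) = ad_e7 A - ad_e7 M.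
Proof. by rewrite -scaleN1r ad_e7D ad_e7Z scaleN1r. Qed.

Lemma ad_e7M (M N : 'M[R]_6) : ad_e7 M *m ad_e7 N = ad_e7 (M *m N).
Proof.
apply: (etrans (@mulmx_block R 6 1 6 1 6 1 M 0 0 0 N 0 0 0)).
by rewrite !mul0mx !mulmx0 !addr0.
Qed.

Lemma coclosedE (A : 'M[R]_6) :
  coclosed A <-> vanishes_on_h (theta (ad_e7 A) psi).
Proof.
rewrite -(ext7_eq0 (alternating_theta _ (@alternating_psi R))
  (multilinear_theta _ (@multilinear_psi R))).
have E x : ext_d A psi x = ext7 (theta (ad_e7 A) psi) x.
  by apply: ext_dE; [exact: (@alternating_psi R)|exact: (@multilinear_psi R)].
by split=> h x; [rewrite -E|rewrite E]; exact: h.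
Qed.

(** Since d phi = e^7 /\ theta (ad_e7 A) phi, taking the star of it produces
    the sign (-1)^3 of hodge_ext7 and the sign of hodge_theta, which cancel. *)
Lemma codiff_psi (A : 'M[R]_6) x : \tr A = 0 ->
  codiff A psi x = iota7 (theta (ad_e7 A^T) psi) x.
Proof.
move=> tr0; rewrite /codiff [@hodge R 4 (7 - 4) _]hodge_psi.
have -> : ext_d A phi = ext7 (theta (ad_e7 A) phi).
  by apply/funext => y; apply: ext_dE;
    [exact: (@alternating_phi R)|exact: (@multilinear_phi R)].
rewrite (@hodge_ext7 R 3 3) // /iota7 (@hodge_theta R 3 4) //; last exact: (@multilinear_phi R).
rewrite ad_e7_trace tr0 mul0r subr0 ad_e7_tr -[@hodge R 3 4 _]/psi.
by rewrite /= ; ring.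
Qed.

Lemma hodge0 k l (x : 'I_l -> V) : @hodge R k l (fun=> 0) x = 0.
Proof. by rewrite /hodge big1 ?mulr0 // => f _; rewrite mul0r. Qed.

Lemma ext_d0 (A : 'M[R]_6) k x : ext_d A ((fun=> 0) : form R k) x = 0.
Proof. by rewrite /ext_d big1 // => j _; rewrite big1 // => i _; rewrite mulr0. Qed.

(** With d psi = 0 the Laplacian is d d^* psi.  The derivation theta (ad_e7 A)
    commutes with the interior product iota7 contained in d^* psi, and the
    remaining e^7 /\ iota7 is the identity on forms that vanish on h.  It is
    the coclosedness of A^T that makes theta (ad_e7 A^T) psi vanish on h. *)
Lemma hodge_laplacian_psi (A : 'M[R]_6) x :
  coclosed A -> coclosed A^T -> \tr A = 0 ->
  hodge_laplacian A psi x =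
  theta (ad_e7 A) (theta (ad_e7 A^T) psi) x.
Proof.
move=> cA cAT tr0; rewrite /hodge_laplacian /=.
have -> : codiff A psi = iota7 (theta (ad_e7 A^T) psi).
  by apply/funext => y; apply: codiff_psi.
have -> : ext_d A psi = ((fun=> 0) : form R 5) by apply/funext => y; apply: cA.
have mlT := multilinear_theta (ad_e7 A^T) (@multilinear_psi R).
have altT := alternating_theta (ad_e7 A^T) (@alternating_psi R).
have -> : codiff A ((fun=> 0) : form R 5) x = 0.
  rewrite /codiff (_ : @hodge R 5 (7 - 5) _ = ((fun=> 0) : form R 2)); last first.
    by apply/funext => y; apply: hodge0.
  rewrite (_ : ext_d A _ = ((fun=> 0) : form R 3)); last first.
    by apply/funext => y; apply: ext_d0.
  by rewrite hodge0 mulr0.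
rewrite addr0 ext_dE; [|exact: alternating_iota7|exact: multilinear_iota7].
rewrite iota7_theta ?ad_e7_e7 // ext7_iota7 //.
- exact: alternating_theta.
- exact: multilinear_theta.
apply: vanishes_on_h_theta => // [m _|]; first exact: ad_e7_row.
by apply/coclosedE.
Qed.

End Laplacian.

(** * Linear algebra of the coordinate functions *)

Section Coordinates.
Variable R : realType.
Implicit Types (u v w z : nat -> R) (a : nat -> nat -> R).

(** In polynomial identities, vectors and matrices are replaced by functions on
    nat: applied to numerals these reduce by computation, unlike ordinals. *)
Definition kdelta (i n : nat) : R := if eqn n i then 1 else 0.

Definition sum6 (f : nat -> R) : R :=
  f 0%N + f 1%N + f 2%N + f 3%N + f 4%N + f 5%N.

Lemma big_sum6 (F : nat -> R) : \sum_(i < 6) F i = sum6 F.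
Proof. by rewrite !big_ord_recl big_ord0 /sum6 addr0 !addrA. Qed.

Definition omega2 u v : R := det2 u v 1 2 + det2 u v 3 4 + det2 u v 5 6.

Definition half_omega_sq u v w z : R :=
  omega2 u v * omega2 w z - omega2 u w * omega2 v z + omega2 u z * omega2 v w.

Definition rho_plus3 u v w : R :=
  det3 u v w 1 3 5 - det3 u v w 1 4 6 - det3 u v w 2 4 5 - det3 u v w 2 3 6.

Definition rho_minus3 u v w : R :=
  det3 u v w 1 4 5 + det3 u v w 1 3 6 + det3 u v w 2 3 5 - det3 u v w 2 4 6.

(** The contraction of rho^- with the basis vector of index c.  Written out, it
    has four monomials instead of twenty-four, which keeps the polynomial
    identities below small. *)
Definition rho_minus_at (c : nat) u v : R :=
  match c with
  | 0%N => det2 u v 4 5 + det2 u v 3 6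
  | 1%N => det2 u v 3 5 - det2 u v 4 6
  | 2%N => det2 u v 6 1 + det2 u v 5 2
  | 3%N => det2 u v 5 1 - det2 u v 6 2
  | 4%N => det2 u v 1 4 + det2 u v 2 3
  | _ => det2 u v 1 3 - det2 u v 2 4
  end.

Lemma rho_minus_kdelta u v c : (c < 6)%N -> rho_minus3 u v (kdelta c) = rho_minus_at c u v.
Proof.
move: c => [|[|[|[|[|[|//]]]]]] _; rewrite /rho_minus3 /rho_minus_at /det3 /det2 /kdelta /=.
all: by ring.
Qed.

Lemma rho_minus3_swap u v w : rho_minus3 u v w = - rho_minus3 u w v.
Proof. by rewrite /rho_minus3 /det3 /det2; ring. Qed.

Lemma rho_minus3_cycle u v w : rho_minus3 u v w = rho_minus3 v w u.
Proof. by rewrite /rho_minus3 /det3 /det2; ring. Qed.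

Lemma eq_rho_minus_at c u v u' v' : (forall n, (n < 6)%N -> u n = u' n) ->
  (forall n, (n < 6)%N -> v n = v' n) -> rho_minus_at c u v = rho_minus_at c u' v'.
Proof.
move=> eu ev; rewrite /rho_minus_at /det2 /=.
by move: c => [|[|[|[|[|]]]]]; rewrite !eu // !ev.
Qed.

(** The contraction of a bilinear expression F with the 2-form obtained by
    inserting the basis vector of index c into rho^+. *)
Definition contract_rho_plus (F : nat -> nat -> R) (c : nat) : R :=
  match c with
  | 0%N => F 2%N 4%N - F 4%N 2%N - (F 3%N 5%N - F 5%N 3%N)
  | 1%N => - (F 3%N 4%N - F 4%N 3%N) - (F 2%N 5%N - F 5%N 2%N)
  | 2%N => F 4%N 0%N - F 0%N 4%N - (F 5%N 1%N - F 1%N 5%N)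
  | 3%N => - (F 5%N 0%N - F 0%N 5%N) - (F 4%N 1%N - F 1%N 4%N)
  | 4%N => F 0%N 2%N - F 2%N 0%N - (F 1%N 3%N - F 3%N 1%N)
  | _ => - (F 0%N 3%N - F 3%N 0%N) - (F 1%N 2%N - F 2%N 1%N)
  end.

Lemma contract_rho_plusE F c : (c < 6)%N ->
  sum6 (fun m => sum6 (fun p => rho_plus3 (kdelta m) (kdelta p) (kdelta c) * F m p)) =
    contract_rho_plus F c.
Proof.
case: c => [|[|[|[|[|[|//]]]]]] _; rewrite /sum6 /rho_plus3 /det3 /det2 /kdelta /=; ring.
Qed.

Definition circ6_entries a (i j : nat) : R :=
  contract_rho_plus (fun m p => contract_rho_plus (fun n q => a m n * a p q) j) i.

(** The equation A J + J A^T = 0 solved for fifteen entries: in 2 x 2 blocks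
    (p, q; r, s), the block (j, i) has last entry - p, and q, r are the same in
    the blocks (i, j) and (j, i). *)
Definition sp_entries a : Prop :=
  ([/\ a 1%N 1%N = - a 0%N 0%N, a 1%N 3%N = - a 2%N 0%N,
       a 1%N 5%N = - a 4%N 0%N & a 3%N 1%N = - a 0%N 2%N] /\
   [/\ a 3%N 3%N = - a 2%N 2%N, a 3%N 5%N = - a 4%N 2%N,
       a 5%N 1%N = - a 0%N 4%N &
       a 5%N 3%N = - a 2%N 4%N /\ a 5%N 5%N = - a 4%N 4%N] /\
   [/\ a 2%N 1%N = a 0%N 3%N, a 4%N 1%N = a 0%N 5%N & a 4%N 3%N = a 2%N 5%N] /\
   [/\ a 3%N 0%N = a 1%N 2%N, a 5%N 0%N = a 1%N 4%N & a 5%N 2%N = a 3%N 4%N]).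

End Coordinates.

Section SymplecticEntries.
Variable R : realType.
Local Notation kdelta := (@kdelta R).
Implicit Type a : nat -> nat -> R.

(** The 2-form - theta A omega, for the matrix A with entries a. *)
Definition dot_omega a (i j : nat) : R :=
  omega2 (fun n => a n i) (kdelta j) + omega2 (kdelta i) (fun n => a n j).

(** The exterior product of omega with the 2-form dot_omega a, at four basis
    vectors. *)
Definition omega_wedge_dot a (i j k l : nat) : R :=
  omega2 (kdelta i) (kdelta j) * dot_omega a k l
    - omega2 (kdelta i) (kdelta k) * dot_omega a j l
  + omega2 (kdelta i) (kdelta l) * dot_omega a j k
    + omega2 (kdelta j) (kdelta k) * dot_omega a i l
  - omega2 (kdelta j) (kdelta l) * dot_omega a i k
    + omega2 (kdelta k) (kdelta l) * dot_omega a i j.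

Lemma sp_entries_dot_omega a : sp_entries a ->
  forall i j, (i < j < 6)%N -> dot_omega a i j = 0.
Proof.
move=> [[h1 h2 h3 h4] [[h5 h6 h7 [h8 h9]] [[h10 h11 h12] [h13 h14 h15]]]].
move=> [|[|[|[|[|i]]]]] [|[|[|[|[|[|j]]]]]] // ij.
all: try by exfalso; lia.
all: rewrite /dot_omega /omega2 /det2 /kdelta /=
  ?(h1,h2,h3,h4,h5,h6,h7,h8,h9,h10,h11,h12,h13,h14,h15).
all: by ring.
Qed.

(** The exterior product with omega is injective on 2-forms of R^6.  If i and j
    lie in different planes of omega, multiply by the third plane; the three
    planes themselves give the pairwise sums of three numbers. *)
Lemma omega_wedge_dot_eq0 a :
  (forall i j k l, (i < j < k)%N -> (k < l < 6)%N ->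
     omega_wedge_dot a i j k l = 0) <-> sp_entries a.
Proof.
split=> [q|/sp_entries_dot_omega b0 i j k l ijk kl]; last first.
  by rewrite /omega_wedge_dot !b0 ?mulr0 ?subr0 ?addr0 //; lia.
have q0 := q 0%N 1%N 2%N 3%N isT isT. have q1 := q 0%N 1%N 2%N 4%N isT isT.
have q2 := q 0%N 1%N 2%N 5%N isT isT. have q3 := q 0%N 1%N 3%N 4%N isT isT.
have q4 := q 0%N 1%N 3%N 5%N isT isT. have q5 := q 0%N 1%N 4%N 5%N isT isT.
have q6 := q 0%N 2%N 3%N 4%N isT isT. have q7 := q 0%N 2%N 3%N 5%N isT isT.
have q8 := q 0%N 2%N 4%N 5%N isT isT. have q9 := q 0%N 3%N 4%N 5%N isT isT.
have p0 := q 1%N 2%N 3%N 4%N isT isT. have p1 := q 1%N 2%N 3%N 5%N isT isT.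
have p2 := q 1%N 2%N 4%N 5%N isT isT. have p3 := q 1%N 3%N 4%N 5%N isT isT.
have p4 := q 2%N 3%N 4%N 5%N isT isT.
clear q; rewrite /omega_wedge_dot /dot_omega /omega2 /det2 /kdelta /= in
  q0 q1 q2 q3 q4 q5 q6 q7 q8 q9 p0 p1 p2 p3 p4.
split; [|split; [|split]].
- by split; [clear -q0 q5 p4|clear -q9|clear -q7|clear -p2]; lra.
- by split; [clear -q0 q5 p4|clear -q2|clear -p0
    |split; [clear -q3|clear -q0 q5 p4]]; lra.
- by split; [clear -p3|clear -p1|clear -q4]; lra.
- by split; [clear -q8|clear -q6|clear -q1]; lra.
Qed.

(** Minus the components of theta B psi, for the matrix B with entries a, at four
    vectors of h and at three vectors of h followed by e_7. *)
Definition theta_component_h a (i j k l : nat) : R :=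
  omega_wedge_dot a i j k l
  + rho_minus_at l (kdelta i) (kdelta k) * a 6%N j
    - rho_minus_at l (kdelta j) (kdelta k) * a 6%N i
  + rho_minus_at k (kdelta i) (kdelta j) * a 6%N l
    - rho_minus_at l (kdelta i) (kdelta j) * a 6%N k.

Definition theta_component_e7 a (i j k : nat) : R :=
  let A i n := a n i in
  rho_minus_at k (A i) (kdelta j) + rho_minus_at k (kdelta i) (A j)
    + rho_minus_at i (kdelta j) (A k)
  + half_omega_sq (kdelta i) (kdelta j) (kdelta k) (A 6%N)
    + rho_minus_at k (kdelta i) (kdelta j) * a 6%N 6%N.

Ltac solve_components :=
  rewrite /theta_component_h /theta_component_e7 /omega_wedge_dot /dot_omega /half_omega_sq
    /rho_minus_at /omega2 /det2 /kdelta /=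
      ?(mul0r, mulr0, mul1r, mulr1, subr0, sub0r, addr0, add0r);
  move=> *; do ?split; lra.

(** The seven monomials of phi are the lines of a Fano plane, and those of psi
    are their complements.  A component of theta B psi on the complement of a line
    is the sum of four diagonal entries of B; these seven sums determine the
    diagonal.  On any other quadruple, namely a line and a point p outside it,
    the component is a signed sum of the three entries b_xy for which {p, x, y}
    is a line.  The four quadruples attached to p carry different signs, and
    three of them suffice to make the three entries vanish. *)
Lemma theta_component_inj (b : nat -> nat -> R) : (forall i j, b i j = b j i) ->
  (forall i j k l, (i < j < k)%N -> (k < l < 6)%N -> theta_component_h b i j k l = 0) ->
  (forall i j k, (i < j < k)%N -> (k < 6)%N -> theta_component_e7 b i j k = 0) ->
  forall i j, (i < 7)%N -> (j < 7)%N -> b i j = 0.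
Proof.
move=> sym c c7.
have [x0 [y0 z0]] : b 0%N 6%N = 0 /\ b 2%N 5%N = 0 /\ b 3%N 4%N = 0.
  have := c 0%N 1%N 2%N 4%N isT isT; have := c 0%N 1%N 3%N 5%N isT isT.
  have := c7 1%N 2%N 3%N isT isT.
  have := sym 0%N 6%N; have := sym 2%N 5%N.
  by have := sym 3%N 4%N; clear; solve_components.
have [x1 [y1 z1]] : b 1%N 6%N = 0 /\ b 2%N 4%N = 0 /\ b 3%N 5%N = 0.
  have := c 0%N 1%N 2%N 5%N isT isT; have := c 0%N 1%N 3%N 4%N isT isT.
  have := c7 0%N 2%N 3%N isT isT.
  have := sym 1%N 6%N; have := sym 2%N 4%N.
  by have := sym 3%N 5%N; clear; solve_components.
have [x2 [y2 z2]] : b 0%N 4%N = 0 /\ b 1%N 5%N = 0 /\ b 3%N 6%N = 0.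
  have := c7 0%N 1%N 2%N isT isT; have := c 0%N 2%N 3%N 5%N isT isT.
  have := c 1%N 2%N 3%N 4%N isT isT.
  have := sym 0%N 4%N; have := sym 1%N 5%N.
  by have := sym 3%N 6%N; clear; solve_components.
have [x3 [y3 z3]] : b 0%N 5%N = 0 /\ b 1%N 4%N = 0 /\ b 2%N 6%N = 0.
  have := c7 0%N 1%N 3%N isT isT; have := c 0%N 2%N 3%N 4%N isT isT.
  have := c 1%N 2%N 3%N 5%N isT isT.
  have := sym 0%N 5%N; have := sym 1%N 4%N.
  by have := sym 2%N 6%N; clear; solve_components.
have [x4 [y4 z4]] : b 0%N 2%N = 0 /\ b 1%N 3%N = 0 /\ b 5%N 6%N = 0.
  have := c7 0%N 1%N 4%N isT isT; have := c 0%N 3%N 4%N 5%N isT isT.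
  have := c 1%N 2%N 4%N 5%N isT isT.
  have := sym 0%N 2%N; have := sym 1%N 3%N.
  by have := sym 5%N 6%N; clear; solve_components.
have [x5 [y5 z5]] : b 0%N 3%N = 0 /\ b 1%N 2%N = 0 /\ b 4%N 6%N = 0.
  have := c7 0%N 1%N 5%N isT isT; have := c 0%N 2%N 4%N 5%N isT isT.
  have := c 1%N 3%N 4%N 5%N isT isT.
  have := sym 0%N 3%N; have := sym 1%N 2%N.
  by have := sym 4%N 6%N; clear; solve_components.
have [x6 [y6 z6]] : b 0%N 1%N = 0 /\ b 2%N 3%N = 0 /\ b 4%N 5%N = 0.
  have := c7 0%N 2%N 4%N isT isT; have := c7 0%N 3%N 5%N isT isT.
  have := c7 1%N 2%N 5%N isT isT.
  have := sym 0%N 1%N; have := sym 2%N 3%N.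
  by have := sym 4%N 5%N; clear; solve_components.
have : (b 0%N 0%N = 0 /\ b 1%N 1%N = 0) /\ (b 2%N 2%N = 0 /\ b 3%N 3%N = 0) /\
    (b 4%N 4%N = 0 /\ b 5%N 5%N = 0) /\ b 6%N 6%N = 0.
  have := c 0%N 1%N 2%N 3%N isT isT; have := c 0%N 1%N 4%N 5%N isT isT.
  have := c 2%N 3%N 4%N 5%N isT isT; have := c7 0%N 2%N 5%N isT isT.
  have := c7 0%N 3%N 4%N isT isT; have := c7 1%N 2%N 4%N isT isT.
  by have := c7 1%N 3%N 5%N isT isT; clear; solve_components.
move=> [[d0 d1] [[d2 d3] [[d4 d5] d6]]]; clear c c7.
by move=> [|[|[|[|[|[|[|//]]]]]]] [|[|[|[|[|[|[|//]]]]]]] _ _ //; rewrite sym.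
Qed.

End SymplecticEntries.

(** * The components of psi and of its derivatives *)

Section Components.
Variable R : realType.
Local Notation V := 'cV[R]_7.
Local Notation psi := (@Defs.psi R).
Local Notation kdelta := (@kdelta R).
Implicit Types (B : 'M[R]_7) (A M N : 'M[R]_6) (u v w z : V).

Definition ebasis (i : nat) : V := basis R (inord i).

Lemma coordn_ebasis i n : (i < 7)%N -> (n < 7)%N -> coordn (ebasis i) n = kdelta i n.
Proof.
move=> i7 n7; rewrite /coordn /ebasis /basis mxE eqxx andbT /kdelta.
rewrite (_ : (inord n == inord i :> 'I_7) = eqn n i); first by case: eqn.
by rewrite -val_eqE /= !inordK.
Qed.

Lemma coordn_ebasis_h i n : (i < 6)%N -> (n < 7)%N -> coordn (ebasis i) n = kdelta i n.
Proof. by move=> i6 n7; rewrite coordn_ebasis // ltnW. Qed.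

Lemma coordn_ebasis_h6 i : (i < 6)%N -> coordn (ebasis i) 6 = 0.
Proof. by move=> i6; rewrite coordn_ebasis_h // /kdelta; case: eqnP i6 => [<-|]. Qed.

Lemma coordn_mul B i : coordn (B *m ebasis i) = fun n => B (inord n) (inord i).
Proof. by apply/funext => n; rewrite /coordn /ebasis -colE mxE. Qed.

Lemma basis_h_ebasis (i : 'I_6) : basis_h R i = ebasis i.
Proof. by congr basis; apply/val_inj; rewrite /= inordK // ltnS ltnW. Qed.

Lemma upd_arg4 u v w z t :
  [/\ upd (@arg R 4 [:: u; v; w; z]) ord0 t = arg [:: t; v; w; z],
      upd (@arg R 4 [:: u; v; w; z]) (lift ord0 ord0) t = arg [:: u; t; w; z],
      upd (@arg R 4 [:: u; v; w; z]) (lift ord0 (lift ord0 ord0)) t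
        = arg [:: u; v; t; z] &
      upd (@arg R 4 [:: u; v; w; z]) (lift ord0 (lift ord0 (lift ord0 ord0))) t
        = arg [:: u; v; w; t]].
Proof. by split; apply/funext => -[[|[|[|[|]]]]]. Qed.

Lemma theta_arg4 B (alpha : form R 4) u v w z :
  theta B alpha (arg [:: u; v; w; z]) =
  - (alpha (arg [:: B *m u; v; w; z]) + alpha (arg [:: u; B *m v; w; z])
     + alpha (arg [:: u; v; B *m w; z]) + alpha (arg [:: u; v; w; B *m z])).
Proof.
rewrite thetaE !big_ord_recl big_ord0 addr0 !addrA.
case: (upd_arg4 u v w z (B *m u)) => -> _ _ _.
case: (upd_arg4 u v w z (B *m v)) => _ -> _ _.
case: (upd_arg4 u v w z (B *m w)) => _ _ -> _.
by case: (upd_arg4 u v w z (B *m z)) => _ _ _ ->.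
Qed.

Lemma psi_arg4_eq0 u v w :
  [/\ psi (arg [:: 0; u; v; w]) = 0, psi (arg [:: u; 0; v; w]) = 0,
      psi (arg [:: u; v; 0; w]) = 0 & psi (arg [:: u; v; w; 0]) = 0].
Proof.
have z x i : psi (upd x i 0) = 0 by apply/multilinear0/multilinear_psi.
split.
- by have [<- _ _ _] := upd_arg4 0 u v w 0.
- by have [_ <- _ _] := upd_arg4 u 0 v w 0.
- by have [_ _ <- _] := upd_arg4 u v 0 w 0.
- by have [_ _ _ <-] := upd_arg4 u v w 0 0.
Qed.

(** psi is half the square of omega plus rho^- exterior e^7. *)
Lemma psi_arg4 u v w z :
  psi (arg [:: u; v; w; z]) = half_omega_sq (coordn u) (coordn v) (coordn w) (coordn z)
    + rho_minus3 (coordn u) (coordn v) (coordn w) * coordn z 6%N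
      - rho_minus3 (coordn u) (coordn v) (coordn z) * coordn w 6%N
    + rho_minus3 (coordn u) (coordn w) (coordn z) * coordn v 6%N
      - rho_minus3 (coordn v) (coordn w) (coordn z) * coordn u 6%N.
Proof.
rewrite psiE /psi_sum /G2_table !big_cons big_nil /= !dxk4.
move: (coordn u) (coordn v) (coordn w) (coordn z) => a b c d.
by rewrite /half_omega_sq /omega2 /rho_minus3 /det4 /det3 /det2 /=; ring.
Qed.

Lemma psi_e7 u v w : psi (arg [:: u; v; w; ebasis 6]) =
  rho_minus3 (coordn u) (coordn v) (coordn w).
Proof.
have om0 f : omega2 f (coordn (ebasis 6)) =
  0 by rewrite /omega2 /det2 /= !coordn_ebasis // /kdelta /=; ring.
have rm0 f g : rho_minus3 f g (coordn (ebasis 6)) = 0.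
  by rewrite /rho_minus3 /det3 /det2 /= !coordn_ebasis // /kdelta /=; ring.
by rewrite psi_arg4 /half_omega_sq !om0 !rm0 coordn_ebasis // /kdelta /=; ring.
Qed.

Lemma psi_basis_e7 u v c : (c < 6)%N ->
  [/\ psi (arg [:: u; v; ebasis c; ebasis 6]) = rho_minus_at c (coordn u) (coordn v),
      psi (arg [:: u; ebasis c; v; ebasis 6]) = - rho_minus_at c (coordn u) (coordn v) &
      psi (arg [:: ebasis c; u; v; ebasis 6]) = rho_minus_at c (coordn u) (coordn v)].
Proof.
move=> c6; rewrite !psi_e7 (rho_minus3_swap _ (coordn (ebasis c)))
  (rho_minus3_cycle (coordn (ebasis c))).
by rewrite -!rho_minus_kdelta // /rho_minus3 /det3 /det2 /= !coordn_ebasis_h.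
Qed.

Lemma psi_basis3_e7 i j k : (i < 6)%N -> (j < 6)%N -> (k < 6)%N ->
  psi (arg [:: ebasis i; ebasis j; ebasis k; ebasis 6]) = rho_minus_at k (kdelta i) (kdelta j).
Proof.
move=> i6 j6 k6; have [-> _ _] := psi_basis_e7 (ebasis i) (ebasis j) k6.
by apply: eq_rho_minus_at => n n6; rewrite coordn_ebasis_h // ltnW.
Qed.

Lemma theta_psi_h B i j k l : (i < j < k)%N -> (k < l < 6)%N ->
  theta B psi (arg [:: ebasis i; ebasis j; ebasis k; ebasis l]) =
  - theta_component_h (fun i j => B (inord i) (inord j)) i j k l.
Proof.
move=> ijk kl.
have [i6 j6 k6 l6] : [/\ (i < 6)%N, (j < 6)%N, (k < 6)%N & (l < 6)%N] by split; lia.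
have oml f m : (m < 6)%N -> omega2 (coordn (ebasis m)) f = omega2 (kdelta m) f.
  by move=> m6; rewrite /omega2 /det2 /= !coordn_ebasis_h.
have omr f m : (m < 6)%N -> omega2 f (coordn (ebasis m)) = omega2 f (kdelta m).
  by move=> m6; rewrite /omega2 /det2 /= !coordn_ebasis_h.
have rmb m n p : (m < 6)%N -> (n < 6)%N -> (p < 6)%N ->
    rho_minus3 (coordn (ebasis m)) (coordn (ebasis n)) (coordn (ebasis p)) =
      rho_minus_at p (kdelta m) (kdelta n).
  by move=> m6 n6 p6; rewrite -psi_e7 psi_basis3_e7.
rewrite theta_arg4 !psi_arg4 !coordn_ebasis_h6 // !coordn_mul !mulr0 !rmb //.
rewrite /half_omega_sq !oml // !omr //.
by rewrite /theta_component_h /omega_wedge_dot /dot_omega; ring.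
Qed.

Lemma theta_psi_e7 B i j k : (i < j < k)%N -> (k < 6)%N ->
  theta B psi (arg [:: ebasis i; ebasis j; ebasis k; ebasis 6]) =
  - theta_component_e7 (fun i j => B (inord i) (inord j)) i j k.
Proof.
move=> ijk k6; have [i6 j6] : (i < 6)%N /\ (j < 6)%N by split; lia.
set a := fun i j : nat => B (inord i) (inord j).
have e m n : (m < 6)%N -> (n < 6)%N -> coordn (ebasis m) n = kdelta m n.
  by move=> m6 n6; rewrite coordn_ebasis_h // ltnW.
have [u1 _ _] := psi_basis_e7 (B *m ebasis i) (ebasis j) k6.
have [u2 _ _] := psi_basis_e7 (ebasis i) (B *m ebasis j) k6.
have [_ _ u3] := psi_basis_e7 (ebasis j) (B *m ebasis k) i6.
rewrite theta_arg4 u1 u2 u3 psi_arg4 -psi_e7 psi_basis3_e7 // !coordn_ebasis_h6 // !coordn_mul.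
rewrite !mulr0 !subr0 !addr0.
rewrite (@eq_rho_minus_at _ _ _ (coordn (ebasis j)) (a^~ i) (kdelta j)) // => [|n n6];
  last exact: e.
rewrite (@eq_rho_minus_at _ _ (coordn (ebasis i)) _ (kdelta i) (a^~ j)) // => [|n n6];
  last exact: e.
rewrite (@eq_rho_minus_at _ _ (coordn (ebasis j)) _ (kdelta j) (a^~ k)) // => [|n n6];
  last exact: e.
by rewrite /theta_component_e7 /half_omega_sq /omega2 /det2 /= !e // /a; ring.
Qed.

(** The matrices B with theta B psi = 0 form the Lie algebra of G_2, which lies
    in so(7), so that no symmetric matrix other than 0 is among them. *)
Lemma theta_psi_inj B : B^T = B -> (forall x, theta B psi x = 0) -> B = 0.
Proof.
move=> symB e0.
have b0 := @theta_component_inj R (fun i j => B (inord i) (inord j)).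
apply/matrixP => i j; rewrite [RHS]mxE -[i]inord_val -[j]inord_val b0 //.
- by move=> m n; rewrite -{1}symB mxE.
- by move=> m n p r mnp pr; apply/eqP; rewrite -oppr_eq0 -theta_psi_h // e0.
- by move=> m n p mnp p6; apply/eqP; rewrite -oppr_eq0 -theta_psi_e7 // e0.
Qed.

Lemma increasing_arg4 (f : 'I_4 -> 'I_7) : increasing f ->
  exists i j k l, [/\ basis R \o f = arg [:: ebasis i; ebasis j; ebasis k; ebasis l],
    (i < j < k)%N, (k < l < 7)%N,
    k = f (lift ord_max ord_max) & l = f ord_max].
Proof.
move=> inc; pose o (n : nat) : 'I_4 := inord n.
have oE n : (n < 4)%N -> o n = n :> nat by move=> n4; rewrite /o inordK.
exists (f (o 0%N)), (f (o 1%N)), (f (o 2%N)), (f (o 3%N)); split.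
- apply/funext => m; rewrite /arg /ebasis !inord_val /=.
  have [n n4 ->] : exists2 n, (n < 4)%N & m = o n by exists m; rewrite // /o inord_val.
  by rewrite oE //; move: n n4 => [|[|[|[|]]]].
- by rewrite !inc ?oE.
- by rewrite inc ?oE //= ltn_ord.
- by congr (nat_of_ord (f _)); apply/val_inj; rewrite /= oE.
- by congr (nat_of_ord (f _)); apply/val_inj; rewrite /= oE.
Qed.

Lemma vanishes_on_h_arg4 (alpha : form R 4) : is_alternating alpha ->
  vanishes_on_h alpha <->
  (forall i j k l, (i < j < k)%N -> (k < l < 6)%N ->
     alpha (arg [:: ebasis i; ebasis j; ebasis k; ebasis l]) = 0).
Proof.
move=> alt; split=> [ah i j k l ijk kl|e f fh].
  pose s := [:: i; j; k; l].
  rewrite (_ : arg _ = basis R \o (fun m : 'I_4 => inord (nth 0%N s m))); last first.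
    by apply/funext; case=> -[|[|[|[|]]]].
  by apply: ah; case=> -[|[|[|[|//]]]] ? /=; rewrite inordK //; lia.
apply: alternating_basis_eq0 => // s inc.
have [i [j [k [l [fE ijk kl7 _ lE]]]]] := increasing_arg4 inc.
have l6 : (l < 6)%N by rewrite lE /=; apply: fh.
by rewrite -compA fE; apply: e => //; rewrite l6 andbT; case/andP: kl7.
Qed.

Lemma eq_form4 (alpha beta : form R 4) :
  is_alternating alpha -> is_alternating beta ->
  is_multilinear alpha -> is_multilinear beta ->
  vanishes_on_h alpha -> vanishes_on_h beta ->
  (forall i j k, (i < j < k)%N -> (k < 6)%N ->
     alpha (arg [:: ebasis i; ebasis j; ebasis k; ebasis 6]) =
       beta (arg [:: ebasis i; ebasis j; ebasis k; ebasis 6])) ->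
  forall x, alpha x = beta x.
Proof.
move=> alta altb mla mlb ah bh e x; apply/eqP; rewrite -subr_eq0; apply/eqP.
apply: (@form_eq0_last R 3 (fun x => alpha x - beta x)) x.
- by move=> y s; rewrite alta altb mulrBr.
- by move=> y i a u v; rewrite mla mlb; ring.
move=> f inc fh; have [l6|/basis_e7 l6] := boolP (f ord_max < 6)%N.
  have fh' i : (f i < 6)%N by case: (unliftP ord_max i) => [m ->|->].
  by rewrite ah // bh // subrr.
have [i [j [k [l [-> ijk kl7 kE lE]]]]] := increasing_arg4 inc.
rewrite (_ : l = 6%N) ?e ?subrr //; first by rewrite kE.
by rewrite lE l6 inordK.
Qed.

End Components.

(** * Coclosed structures and the symplectic Lie algebra *)

Section Symplectic.
Variable R : realType.
Local Notation psi := (@Defs.psi R).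
Local Notation kdelta := (@kdelta R).
Local Notation ebasis := (@ebasis R).
Implicit Types (A M N S : 'M[R]_6) (i j k n : nat).

Definition entry M i j : R := M (inord i) (inord j).

Lemma ad_e7_entry M i j : (i < 6)%N -> (j < 6)%N ->
  ad_e7 M (inord i) (inord j) = entry M i j.
Proof.
have inordE m : (m < 6)%N -> inord m = lshift 1 (inord m : 'I_6) :> 'I_7.
  by move=> m6; apply/val_inj; rewrite /= !inordK // ltnS ltnW.
by move=> i6 j6; rewrite !inordE // ad_e7_h.
Qed.

Lemma eq_entries M N :
  (forall i j, (i < 6)%N -> (j < 6)%N -> entry M i j = entry N i j) -> M = N.
Proof.
move=> e; apply/matrixP => i j.
by have := e i j (ltn_ord i) (ltn_ord j); rewrite /entry !inord_val.
Qed.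

Lemma entry_tr M i j : entry M^T i j = entry M j i.
Proof. by rewrite /entry mxE. Qed.

Lemma entryM M N i j : entry (M *m N) i j = sum6 (fun k => entry M i k * entry N k j).
Proof.
by rewrite /entry mxE -big_sum6; apply: eq_bigr => k _; rewrite inord_val.
Qed.

Lemma mxtrace_entry M : \tr M = sum6 (fun i => entry M i i).
Proof. by rewrite -big_sum6; apply: eq_bigr => i _; rewrite /entry inord_val. Qed.

Lemma entry_J i j : (i < 6)%N -> (j < 6)%N -> entry (J R) i j = omega2 (kdelta j) (kdelta i).
Proof.
move=> i6 j6; rewrite /entry /J mxE.
rewrite (_ : tnth _ = arg [:: basis_h R (inord j); basis_h R (inord i)]); last first.
  by apply/funext => m; rewrite (tnth_nth 0).
by rewrite omegaE !basis_h_ebasis !inordK // /omega2 /det2 /= !coordn_ebasis_h.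
Qed.

Lemma sp6P A : sp6 A <-> sp_entries (entry A).
Proof.
pose Z i j := sum6 (fun k => entry A i k * entry (J R) k j)
  + sum6 (fun k => entry (J R) i k * entry A j k).
have ZE i j : entry (A *m J R + J R *m A^T) i j = Z i j.
  rewrite /Z {1}/entry mxE -2!/(entry _ i j) !entryM; congr (_ + _); rewrite /sum6 !entry_tr //.
have -> : sp6 A <-> (forall i j, (i < 6)%N -> (j < 6)%N -> Z i j = 0).
  split=> [e i j _ _|e]; first by rewrite -ZE e /entry mxE.
  by apply: eq_entries => i j i6 j6; rewrite ZE e // /entry mxE.
rewrite /Z /sum6; split=> [e|].
  have z01 := e 0%N 1%N isT isT. have z03 := e 0%N 3%N isT isT.
  have z05 := e 0%N 5%N isT isT. have z21 := e 2%N 1%N isT isT.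
  have z23 := e 2%N 3%N isT isT. have z25 := e 2%N 5%N isT isT.
  have z41 := e 4%N 1%N isT isT. have z43 := e 4%N 3%N isT isT.
  have z45 := e 4%N 5%N isT isT. have z02 := e 0%N 2%N isT isT.
  have z04 := e 0%N 4%N isT isT. have z24 := e 2%N 4%N isT isT.
  have z13 := e 1%N 3%N isT isT. have z15 := e 1%N 5%N isT isT.
  have z35 := e 3%N 5%N isT isT.
  clear e ZE Z; rewrite !entry_J // /omega2 /det2 /kdelta /= in
    z01 z03 z05 z21 z23 z25 z41 z43 z45 z02 z04 z24 z13 z15 z35.
  split; [|split; [|split]].
  - by split; [clear -z01|clear -z21|clear -z41|clear -z03]; lra.
  - by split; [clear -z23|clear -z43|clear -z05|split; [clear -z25|clear -z45]]; lra.
  - by split; [clear -z02|clear -z04|clear -z24]; lra.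
  - by split; [clear -z13|clear -z15|clear -z35]; lra.
move=> [[h1 h2 h3 h4] [[h5 h6 h7 [h8 h9]] [[h10 h11 h12] [h13 h14 h15]]]] i j i6 j6.
move: i j i6 j6 => [|[|[|[|[|[|//]]]]]] [|[|[|[|[|[|//]]]]]] _ _.
all: rewrite !entry_J // /omega2 /det2 /kdelta /=
  ?(h1,h2,h3,h4,h5,h6,h7,h8,h9,h10,h11,h12,h13,h14,h15).
all: by ring.
Qed.

(** On h the form psi is half the square of omega, so that theta (ad_e7 M) psi
    restricts to omega /\ theta M omega.  By omega_wedge_dot_eq0 this vanishes
    only if theta M omega does. *)
Lemma theta_vanishes_on_h M : vanishes_on_h (theta (ad_e7 M) psi) <-> sp6 M.
Proof.
rewrite (vanishes_on_h_arg4 (alternating_theta _ (@alternating_psi R))) sp6P.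
rewrite -omega_wedge_dot_eq0.
suff E4 i j k l : (i < j < k)%N -> (k < l < 6)%N ->
    theta (ad_e7 M) psi (arg [:: ebasis i; ebasis j; ebasis k; ebasis l]) =
      - omega_wedge_dot (entry M) i j k l.
  split=> e i j k l ijk kl; last by rewrite E4 // e ?oppr0.
  by apply/eqP; rewrite -oppr_eq0 -E4 // e.
move=> ijk kl; rewrite theta_psi_h // /theta_component_h !ad_e7_row !mulr0.
have dotE m n : (m < n < 6)%N ->
    dot_omega (fun i j => ad_e7 M (inord i) (inord j)) m n = dot_omega (entry M) m n.
  move=> /andP[mn n6]; have m6 := ltn_trans mn n6.
  by rewrite /dot_omega /omega2 /det2 /= !ad_e7_entry.
by rewrite /omega_wedge_dot !dotE; [rewrite !addr0 !subr0|lia..].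
Qed.

Lemma coclosed_sp6 A : coclosed A <-> sp6 A.
Proof. by rewrite coclosedE theta_vanishes_on_h. Qed.

Lemma sp6_lin x A M : sp6 A -> sp6 M -> sp6 (x *: A + M).
Proof.
rewrite /sp6 => eA eM; rewrite linearD linearZ /= mulmxDl mulmxDr -scalemxAl -scalemxAr.
by rewrite addrACA -scalerDr eA eM scaler0 addr0.
Qed.

Lemma sp6Z x A : sp6 A -> sp6 (x *: A).
Proof.
move=> eA; rewrite -[_ *: _]addr0; apply: sp6_lin => //.
by rewrite /sp6 mul0mx trmx0 mulmx0 addr0.
Qed.

Lemma sp6D A M : sp6 A -> sp6 M -> sp6 (A + M).
Proof. by move=> eA; rewrite -[A]scale1r; apply: sp6_lin. Qed.

Lemma sp6_commutator A M : sp6 A -> sp6 M -> sp6 (commutator A M).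
Proof.
rewrite /sp6 => /eqP; rewrite addr_eq0 => /eqP eA /eqP; rewrite addr_eq0 => /eqP eM.
rewrite /commutator mulmxBl -!mulmxA eM eA !mulmxN !mulmxA eA eM !mulNmx !opprK.
by rewrite linearB /= !trmx_mul mulmxBr !mulmxA addrC subrKA subrr.
Qed.

Lemma sp6_tr A : sp6 A -> sp6 A^T.
Proof.
move=> /sp6P [[h1 h2 h3 h4] [[h5 h6 h7 [h8 h9]] [[h10 h11 h12] [h13 h14 h15]]]].
apply/sp6P; rewrite /sp_entries !entry_tr h1 h2 h3 h4 h5 h6 h7 h8 h9 h10 h11 h12 h13 h14 h15.
by do !split.
Qed.

Lemma sp6_trace A : sp6 A -> \tr A = 0.
Proof.
by move=> /sp6P [[h1 _ _ _] [[h5 _ _ [_ h9]] _]]; rewrite mxtrace_entry /sum6 h1 h5 h9; ring.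
Qed.

Lemma trace_sq S : \tr (S *m S) = sum6 (fun i => sum6 (fun j => entry S i j * entry S j i)).
Proof. by rewrite mxtrace_entry /sum6 !entryM. Qed.

Lemma trace_J A : \tr (J R *m A) =
  entry A 0 1 - entry A 1 0 + (entry A 2 3 - entry A 3 2) + (entry A 4 5 - entry A 5 4).
Proof. by rewrite mxtrace_entry /sum6 !entryM /sum6 !entry_J // /omega2 /det2 /kdelta /=;
  ring. Qed.

End Symplectic.

(** * The two quadratic identities *)

Section Quadratic.
Variable R : realType.
Local Notation V := 'cV[R]_7.
Local Notation psi := (@Defs.psi R).
Local Notation kdelta := (@kdelta R).
Local Notation ebasis := (@ebasis R).
Local Notation entry := (@entry R).
Implicit Types (a : nat -> nat -> R) (A M N S K : 'M[R]_6).

(** The components at (i, j, k, 7) of theta (ad_e7 A) psi and of its second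
    iterate, in the entries a of A: there are no terms with e_7 replaced, since
    ad_e7 A kills e_7. *)
Definition theta_entries a (i j k : nat) : R :=
  let A i n := a n i in
  - (rho_minus_at k (A i) (kdelta j) + rho_minus_at k (kdelta i) (A j)
    + rho_minus_at i (kdelta j) (A k)).

Definition theta2_entries a (i j k : nat) : R :=
  let A i n := a n i in
  let A2 i n := sum6 (fun k => a n k * a k i) in
  rho_minus_at k (A2 i) (kdelta j) + rho_minus_at k (kdelta i) (A2 j)
    + rho_minus_at i (kdelta j) (A2 k)
  + (rho_minus_at k (A i) (A j) - rho_minus_at j (A i) (A k) + rho_minus_at i (A j) (A k)) *+ 2.

Lemma theta_ad_psi_e7 M i j k : (i < 6)%N -> (j < 6)%N -> (k < 6)%N ->
  theta (ad_e7 M) psi (arg [:: ebasis i; ebasis j; ebasis k; ebasis 6]) =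
    theta_entries (entry M) i j k.
Proof.
move=> i6 j6 k6; rewrite theta_arg4 ad_e7_e7.
have [_ _ _ ->] := psi_arg4_eq0 (ebasis i) (ebasis j) (ebasis k); rewrite addr0 /theta_entries.
have [-> _ _] := psi_basis_e7 (ad_e7 M *m ebasis i) (ebasis j) k6.
have [-> _ _] := psi_basis_e7 (ebasis i) (ad_e7 M *m ebasis j) k6.
have [_ _ ->] := psi_basis_e7 (ebasis j) (ad_e7 M *m ebasis k) i6.
by congr (- (_ + _ + _)); apply: eq_rho_minus_at => n n6;
  rewrite ?coordn_mul ?ad_e7_entry ?coordn_ebasis_h // ltnW.
Qed.

Lemma theta2_ad_psi_e7 M i j k : (i < 6)%N -> (j < 6)%N -> (k < 6)%N ->
  theta (ad_e7 M) (theta (ad_e7 M) psi) (arg [:: ebasis i; ebasis j; ebasis k; ebasis 6])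
  = theta2_entries (entry M) i j k.
Proof.
move=> i6 j6 k6; rewrite theta_arg4 ad_e7_e7 !theta_arg4 ad_e7_e7 !mulmx0.
have z u v w : psi (arg [:: u; v; w; 0]) = 0 by have [] := psi_arg4_eq0 u v w.
rewrite !z !mulmxA ad_e7M !addr0.
set a := entry M; pose A i n := a n i; pose A2 i n := sum6 (fun k => a n k * a k i).
have exE m n : (m < 6)%N -> (n < 6)%N -> coordn (ebasis m) n = kdelta m n.
  by move=> m6 n6; rewrite coordn_ebasis_h // ltnW.
have exA m n : (m < 6)%N -> (n < 6)%N -> coordn (ad_e7 M *m ebasis m) n = A m n.
  by move=> m6 n6; rewrite coordn_mul ad_e7_entry.
have exA2 m n : (m < 6)%N -> (n < 6)%N -> coordn (ad_e7 (M *m M) *m ebasis m) n = A2 m n.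
  by move=> m6 n6; rewrite coordn_mul ad_e7_entry // entryM.
have [-> _ _] := psi_basis_e7 (ad_e7 (M *m M) *m ebasis i) (ebasis j) k6.
have [-> _ _] := psi_basis_e7 (ad_e7 M *m ebasis i) (ad_e7 M *m ebasis j) k6.
have [_ -> _] := psi_basis_e7 (ad_e7 M *m ebasis i) (ad_e7 M *m ebasis k) j6.
have [-> _ _] := psi_basis_e7 (ebasis i) (ad_e7 (M *m M) *m ebasis j) k6.
have [_ _ ->] := psi_basis_e7 (ad_e7 M *m ebasis j) (ad_e7 M *m ebasis k) i6.
have [_ _ ->] := psi_basis_e7 (ebasis j) (ad_e7 (M *m M) *m ebasis k) i6.
have ext := @eq_rho_minus_at R.
rewrite (ext k (coordn (ad_e7 (M *m M) *m ebasis i)) _ (A2 i) (kdelta j)) => [|n|n];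
  try by auto.
rewrite (ext k (coordn (ad_e7 M *m ebasis i)) _ (A i) (A j)) => [|n|n]; try by auto.
rewrite (ext j (coordn (ad_e7 M *m ebasis i)) _ (A i) (A k)) => [|n|n]; try by auto.
rewrite (ext k (coordn (ebasis i)) _ (kdelta i) (A2 j)) => [|n|n]; try by auto.
rewrite (ext i (coordn (ad_e7 M *m ebasis j)) _ (A j) (A k)) => [|n|n]; try by auto.
rewrite (ext i (coordn (ebasis j)) _ (kdelta j) (A2 k)) => [|n|n]; try by auto.
rewrite /theta2_entries -!/(A _) -!/(A2 _).
move: (rho_minus_at _ _ _) (rho_minus_at _ _ _) (rho_minus_at _ _ _) (rho_minus_at _ _ _)
  (rho_minus_at _ _ _) (rho_minus_at _ _ _).
by move=> r1 r2 r3 r4 r5 r6; ring.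
Qed.

(** A symmetric matrix of sp(6) has twelve free entries, a skew one has nine. *)
Lemma symmetric_entries a : sp_entries a -> (forall i j, a i j = a j i) ->
  ((a 1%N 0%N = a 0%N 1%N) * (a 1%N 1%N = - a 0%N 0%N)
    * (a 1%N 2%N = a 0%N 3%N) * (a 1%N 3%N = - a 0%N 2%N)
    * (a 1%N 4%N = a 0%N 5%N) * (a 1%N 5%N = - a 0%N 4%N)
    * (a 2%N 0%N = a 0%N 2%N) * (a 2%N 1%N = a 0%N 3%N)
    * (a 3%N 0%N = a 0%N 3%N) * (a 3%N 1%N = - a 0%N 2%N)
    * (a 3%N 2%N = a 2%N 3%N) * (a 3%N 3%N = - a 2%N 2%N)
    * (a 3%N 4%N = a 2%N 5%N) * (a 3%N 5%N = - a 2%N 4%N)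
    * (a 4%N 0%N = a 0%N 4%N) * (a 4%N 1%N = a 0%N 5%N)
    * (a 4%N 2%N = a 2%N 4%N) * (a 4%N 3%N = a 2%N 5%N)
    * (a 5%N 0%N = a 0%N 5%N) * (a 5%N 1%N = - a 0%N 4%N)
    * (a 5%N 2%N = a 2%N 5%N) * (a 5%N 3%N = - a 2%N 4%N)
    * (a 5%N 4%N = a 4%N 5%N) * (a 5%N 5%N = - a 4%N 4%N))%type.
Proof.
move=> [[h1 h2 h3 h4] [[h5 h6 h7 [h8 h9]] [[h10 h11 h12] [h13 h14 h15]]]] sym.
by do !split; rewrite ?h1 ?h2 ?h3 ?h4 ?h5 ?h6 ?h7 ?h8 ?h9 ?h10 ?h11 ?h12
  -?h13 -?h14 -?h15 // sym.
Qed.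

Lemma skew_entries a : sp_entries a -> (forall i j, a i j = - a j i) ->
  ((a 0%N 0%N = 0) * (a 1%N 1%N = 0) * (a 2%N 2%N = 0) * (a 3%N 3%N = 0)
    * (a 4%N 4%N = 0) * (a 5%N 5%N = 0) * (a 1%N 0%N = - a 0%N 1%N)
    * (a 1%N 2%N = - a 0%N 3%N) * (a 1%N 3%N = a 0%N 2%N)
    * (a 1%N 4%N = - a 0%N 5%N) * (a 1%N 5%N = a 0%N 4%N)
    * (a 2%N 0%N = - a 0%N 2%N) * (a 2%N 1%N = a 0%N 3%N)
    * (a 3%N 0%N = - a 0%N 3%N) * (a 3%N 1%N = - a 0%N 2%N)
    * (a 3%N 2%N = - a 2%N 3%N) * (a 3%N 4%N = - a 2%N 5%N)
    * (a 3%N 5%N = a 2%N 4%N) * (a 4%N 0%N = - a 0%N 4%N)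
    * (a 4%N 1%N = a 0%N 5%N) * (a 4%N 2%N = - a 2%N 4%N)
    * (a 4%N 3%N = a 2%N 5%N) * (a 5%N 0%N = - a 0%N 5%N)
    * (a 5%N 1%N = - a 0%N 4%N) * (a 5%N 2%N = - a 2%N 5%N)
    * (a 5%N 3%N = - a 2%N 4%N) * (a 5%N 4%N = - a 4%N 5%N))%type.
Proof.
move=> [[h1 h2 h3 h4] [[h5 h6 h7 [h8 h9]] [[h10 h11 h12] [h13 h14 h15]]]] skew.
have diag n : a n n = 0 by have := skew n n => h; lra.
by do !split; rewrite ?diag ?h2 ?h3 ?h4 ?h6 ?h7 ?h8 ?h10 ?h11 ?h12 -?h13 -?h14 -?h15
  // skew ?opprK.
Qed.

(** Under SU(3), the symmetric part of sp(6) is S^2 C^3.  Its symmetric square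
    shares with the 3-forms on R^6 only one component S^2 C^3, reached through
    the product S o S, and the invariants, reached through tr S^2.  This
    explains the shape of the right-hand side; the factors come from the entries. *)
Lemma theta2_entries_sym a i j k : (i < j < k)%N -> (k < 6)%N ->
  sp_entries a -> (forall i j, a i j = a j i) ->
  theta2_entries a i j k = 2^-1 * theta_entries (circ6_entries a) i j k
    + 2^-1 * sum6 (fun i => sum6 (fun j => a i j * a j i))
      * rho_minus_at k (kdelta i) (kdelta j).
Proof.
move=> ijk k6 sp sym; have H := symmetric_entries sp sym.
move: i j k ijk k6 => [|[|[|[|i]]]] [|[|[|[|[|j]]]]] [|[|[|[|[|[|k]]]]]] // ijk k6.
all: try by exfalso; lia.
all: clear ijk k6; rewrite /theta2_entries /theta_entries /circ6_entries
  /contract_rho_plus /sum6 /rho_minus_at /det2 /kdelta /= !H.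
all: by field.
Qed.

(** A skew element K of sp(6) belongs to u(3) and multiplies the complex volume
    form rho^+ + i rho^- by an imaginary number of absolute value |tr J K| / 2;
    so the second iterate multiplies rho^- by minus its square.  The trace
    of J K is written out in the entries, see trace_J. *)
Lemma theta2_entries_skew a i j k : (i < j < k)%N -> (k < 6)%N ->
  sp_entries a -> (forall i j, a i j = - a j i) ->
  theta2_entries a i j k =
  - (4^-1 * (a 0%N 1%N - a 1%N 0%N + (a 2%N 3%N - a 3%N 2%N)
             + (a 4%N 5%N - a 5%N 4%N)) ^+ 2) * rho_minus_at k (kdelta i) (kdelta j).
Proof.
move=> ijk k6 sp skew; have H := skew_entries sp skew.
move: i j k ijk k6 => [|[|[|[|i]]]] [|[|[|[|[|j]]]]] [|[|[|[|[|[|k]]]]]] // ijk k6.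
all: try by exfalso; lia.
all: clear ijk k6; rewrite /theta2_entries /sum6 /rho_minus_at /det2 /kdelta /= !H.
all: by field.
Qed.

Lemma sp_entries_circ6 a : sp_entries a -> (forall i j, a i j = a j i) ->
  sp_entries (circ6_entries a).
Proof.
move=> sp sym; have H := symmetric_entries sp sym.
by do !split; rewrite /circ6_entries /contract_rho_plus !H; ring.
Qed.

Lemma rho_coefE (m p c : 'I_6) : rho_coef R m p c = rho_plus3 (kdelta m) (kdelta p) (kdelta c).
Proof.
rewrite /rho_coef (_ : tnth _ = arg [:: ebasis m; ebasis p; ebasis c]); last first.
  by apply/funext => n; rewrite (tnth_nth 0) /= !basis_h_ebasis.
by rewrite /rho_plus /= !dx_dxk !dxk3 /rho_plus3 /det3 /det2 /= !coordn_ebasis_h.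
Qed.

Lemma circ6E S i j : (i < 6)%N -> (j < 6)%N -> entry (circ6 S) i j =
  circ6_entries (entry S) i j.
Proof.
move=> i6 j6; rewrite /entry mxE /circ6_entries -contract_rho_plusE //.
transitivity (\sum_(m < 6) \sum_(p < 6) rho_plus3 (kdelta m) (kdelta p) (kdelta i) *
   \sum_(n < 6) \sum_(q < 6) rho_plus3 (kdelta n) (kdelta q) (kdelta j)
     * (entry S m n * entry S p q)).
  apply: eq_bigr => m _; rewrite exchange_big; apply: eq_bigr => p _ /=.
  rewrite mulr_sumr; apply: eq_bigr => n _; rewrite mulr_sumr; apply: eq_bigr => q _.
  by rewrite !rho_coefE !inordK // /entry !inord_val; ring.
rewrite -big_sum6; apply: eq_bigr => m _; rewrite -big_sum6; apply: eq_bigr => p _.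
congr (_ * _); rewrite -contract_rho_plusE // -big_sum6; apply: eq_bigr => n _.
by rewrite -big_sum6; apply: eq_bigr.
Qed.

Lemma circ6_sym S : S^T = S -> (circ6 S)^T = circ6 S.
Proof.
move=> symS; apply/matrixP => i j; rewrite !mxE exchange_big.
apply: eq_bigr => m _; apply: eq_bigr => n _; rewrite exchange_big.
apply: eq_bigr => p _; apply: eq_bigr => q _.
by rewrite -[in LHS]symS !mxE; ring.
Qed.

Lemma sp6_circ6 S : sp6 S -> S^T = S -> sp6 (circ6 S).
Proof.
move=> /sp6P spS symS; apply/sp6P; rewrite /sp_entries !circ6E //.
by apply: sp_entries_circ6 => // i j; rewrite -entry_tr symS.
Qed.

(** The form theta proj_e7 psi is - rho^- /\ e^7, so that its multiples stand for
    the multiples of rho^- in the two identities above. *)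
Definition proj_e7 : 'M[R]_7 := delta_mx (inord 6) (inord 6).

Lemma proj_e7_basis m : proj_e7 *m basis R m = (m == inord 6)%:R *: basis R m.
Proof.
rewrite /proj_e7 /basis; case: eqP => [->|ne]; first by rewrite mul_delta_mx scale1r.
by rewrite mul_delta_mx_0 ?scale0r // eq_sym; apply/eqP.
Qed.

Lemma vanishes_theta_proj_e7 : vanishes_on_h (theta proj_e7 psi).
Proof.
move=> f fh; rewrite thetaE big1 ?oppr0 // => i _.
rewrite /= proj_e7_basis (_ : _ == _ = false) ?scale0r; last first.
  by apply: contraTF (fh i) => /eqP ->; rewrite inordK.
by rewrite multilinear0 //; apply: multilinear_psi.
Qed.

Lemma theta_proj_e7 i j k : (i < 6)%N -> (j < 6)%N -> (k < 6)%N ->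
  theta proj_e7 psi (arg [:: ebasis i; ebasis j; ebasis k; ebasis 6]) =
    - rho_minus_at k (kdelta i) (kdelta j).
Proof.
move=> i6 j6 k6; rewrite theta_arg4 !proj_e7_basis eqxx scale1r.
have ne m : (m < 6)%N -> (inord m == inord 6 :> 'I_7) = false.
  move=> m6; apply/negbTE.
  by rewrite -val_eqE /= !inordK // ?ltnS 1?ltnW // neq_ltn m6.
rewrite !ne // !scale0r psi_basis3_e7 //.
have [-> _ _ _] := psi_arg4_eq0 (ebasis j) (ebasis k) (ebasis 6).
have [_ -> _ _] := psi_arg4_eq0 (ebasis i) (ebasis k) (ebasis 6).
by have [_ _ -> _] := psi_arg4_eq0 (ebasis i) (ebasis j) (ebasis 6); rewrite !add0r.
Qed.

Lemma vanishes_on_h_theta2 M N : sp6 N ->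
  vanishes_on_h (theta (ad_e7 M) (theta (ad_e7 N) psi)).
Proof.
move=> /theta_vanishes_on_h vN; apply: vanishes_on_h_theta vN.
  exact/multilinear_theta/multilinear_psi.
by move=> m _; rewrite ad_e7_row.
Qed.

Lemma theta2_sym S x : sp6 S -> S^T = S ->
  theta (ad_e7 S) (theta (ad_e7 S) psi) x =
  2^-1 * theta (ad_e7 (circ6 S)) psi x - 2^-1 * \tr (S *m S) * theta proj_e7 psi x.
Proof.
move=> spS symS; have mlt B := multilinear_theta B (@multilinear_psi R).
have altt B := alternating_theta B (@alternating_psi R).
apply: (@eq_form4 R _ (fun x => 2^-1 * theta (ad_e7 (circ6 S)) psi x
  - 2^-1 * \tr (S *m S) * theta proj_e7 psi x)).
- exact: alternating_theta.
- by move=> y s; rewrite !altt; move: ((-1) ^+ s) => ?; ring.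
- exact: multilinear_theta.
- by move=> y i c u v; rewrite !mlt; ring.
- exact: vanishes_on_h_theta2.
- have /theta_vanishes_on_h v := sp6_circ6 spS symS.
  by move=> f fh; rewrite v // vanishes_theta_proj_e7 //; ring.
move=> i j k ijk k6; have [i6 j6] : (i < 6)%N /\ (j < 6)%N by split; lia.
rewrite theta2_ad_psi_e7 // theta_ad_psi_e7 // theta_proj_e7 // theta2_entries_sym //;
  first last.
- by move=> m n; rewrite -entry_tr symS.
- exact/sp6P.
rewrite [X in _ - X]mulrN opprK trace_sq; congr (_ * _ + _).
rewrite /theta_entries; congr (- (_ + _ + _)); apply: eq_rho_minus_at => // n n6;
  by rewrite circ6E.
Qed.

Lemma theta2_skew K x : sp6 K -> K^T = - K ->
  theta (ad_e7 K) (theta (ad_e7 K) psi) x =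
  4^-1 * (\tr (J R *m K)) ^+ 2 * theta proj_e7 psi x.
Proof.
move=> spK skewK; have mlt B := multilinear_theta B (@multilinear_psi R).
have altt B := alternating_theta B (@alternating_psi R).
apply: (@eq_form4 R _ (fun x => 4^-1 * (\tr (J R *m K)) ^+ 2 * theta proj_e7 psi x)).
- exact: alternating_theta.
- by move=> y s; rewrite !altt; move: ((-1) ^+ s) => ?; ring.
- exact: multilinear_theta.
- by move=> y i c u v; rewrite !mlt; ring.
- exact: vanishes_on_h_theta2.
- by move=> f fh; rewrite vanishes_theta_proj_e7 // mulr0.
move=> i j k ijk k6; have [i6 j6] : (i < 6)%N /\ (j < 6)%N by split; lia.
rewrite theta2_ad_psi_e7 // theta_proj_e7 // theta2_entries_skew //; first last.
- by move=> m n; rewrite -entry_tr skewK /entry mxE.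
- exact/sp6P.
by rewrite trace_J mulNr mulrN.
Qed.

End Quadratic.

(** * The endomorphism Q_A and the bracket flow *)

Section Flow.
Variable R : realType.
Local Notation psi := (@Defs.psi R).
Local Notation proj_e7 := (@proj_e7 R).
Implicit Types A M N : 'M[R]_6.

Definition laplacian_h A : 'M[R]_6 :=
  2^-1 *: commutator A A^T + 2^-1 *: circ6 (sym_part A).

Definition laplacian_e7 A : R :=
  - (2^-1 * \tr (sym_part A *m sym_part A) + 4^-1 * (\tr (J R *m A)) ^+ 2).

Lemma sp6_laplacian_h A : sp6 A -> sp6 (laplacian_h A).
Proof.
move=> spA; apply: sp6D; apply: sp6Z.
  by apply: sp6_commutator => //; apply: sp6_tr.
apply: sp6_circ6; first by apply/sp6Z/sp6D => //; apply: sp6_tr.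
by rewrite /sym_part linearZ linearD /= trmxK addrC.
Qed.

(** Write A = S + K with S symmetric and K skew, so that A^T = S - K.  Then
    theta (ad_e7 A) theta (ad_e7 A^T) is the square of theta (ad_e7 S), minus
    the square of theta (ad_e7 K), plus theta of the commutator of ad_e7 K and
    ad_e7 S, and [K, S] = [A, A^T] / 2. *)
Lemma laplacian_endoP A : sp6 A ->
  is_laplacian_endo A (ad_e7 (laplacian_h A) + laplacian_e7 A *: proj_e7).
Proof.
move=> spA; set S := sym_part A; pose K := 2^-1 *: (A - A^T).
have spT := sp6_tr spA.
have symS : S^T = S by rewrite /S /sym_part linearZ linearD /= trmxK addrC.
have skewK : K^T = - K by rewrite /K linearZ linearB /= trmxK -scalerN opprB.
have spS : sp6 S by apply/sp6Z/sp6D.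
have spK : sp6 K by apply/sp6Z; rewrite -scaleN1r; apply/sp6D/sp6Z.
have two M : 2^-1 *: M + 2^-1 *: M = M by rewrite -scalerDl -[RHS]scale1r; congr (_ *: _); lra.
have AE : A = S + K.
  by rewrite /S /sym_part /K -scalerDr addrACA subrr addr0 scalerDr two.
have TE : A^T = S - K.
  by rewrite /S /sym_part /K -scalerBr opprB [A + _]addrC addrACA subrr addr0 scalerDr two.
split.
  rewrite linearD linearZ /= ad_e7_tr /proj_e7 trmx_delta; congr (ad_e7 _ + _).
  rewrite /laplacian_h linearD !linearZ /= circ6_sym //.
  by rewrite /commutator linearB /= !trmx_mul trmxK.
have ml := @multilinear_psi R; have mlt B := multilinear_theta B ml.
move=> x; rewrite hodge_laplacian_psi ?coclosed_sp6 // ?sp6_trace //.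
have KS : K *m S - S *m K = 2^-1 *: commutator A A^T.
  rewrite /commutator /K /S /sym_part -!scalemxAl -!scalemxAr.
  rewrite !(mulmxDl, mulmxDr, mulmxN, mulNmx).
  move: (A *m A) (A *m A^T) (A^T *m A) (A^T *m A^T) => M1 M2 M3 M4.
  by apply/matrixP => i j; rewrite !mxE; field.
have trJ : \tr (J R *m K) = \tr (J R *m A).
  rewrite !trace_J /K /entry !mxE; lra.
rewrite {1}AE TE ad_e7D ad_e7B (thetaDl (ad_e7 S) (ad_e7 K)); last exact: mlt.
have split_theta B : theta B (theta (ad_e7 S - ad_e7 K) psi) x =
    theta B (theta (ad_e7 S) psi) x - theta B (theta (ad_e7 K) psi) x.
  rewrite (@theta_lin R B (-1) 4 (theta (ad_e7 S) psi) (theta (ad_e7 K) psi)) ?mulN1r // => y.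
  by rewrite -scaleN1r thetaDl // thetaZl.
rewrite (split_theta (ad_e7 S)) (split_theta (ad_e7 K)) (theta2_sym x spS symS)
  (theta2_skew x spK skewK) trJ.
have comm := theta_commutator (ad_e7 K) (ad_e7 S) x ml.
rewrite !ad_e7M -ad_e7B KS in comm.
rewrite thetaDl // thetaZl // ad_e7D thetaDl // -comm [ad_e7 (_ *: circ6 _)]ad_e7Z thetaZl //.
rewrite /laplacian_e7 -/S; move: (theta (ad_e7 (circ6 S)) psi x) (theta proj_e7 psi x).
move: (theta (ad_e7 K) (theta (ad_e7 S) psi) x) (theta (ad_e7 S) (theta (ad_e7 K) psi) x).
by move: (\tr (S *m S)) (\tr (J R *m A)) => t1 t2 u1 u2 u3 u4; ring.
Qed.

Lemma laplacian_endoE A : sp6 A ->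
  laplacian_endo A = ad_e7 (laplacian_h A) + laplacian_e7 A *: proj_e7.
Proof.
move=> /laplacian_endoP QP; have [symQ eQ] := QP.
have [symQ' eQ'] : is_laplacian_endo A (laplacian_endo A) by apply: (xgetPex 0);
  exists (ad_e7 (laplacian_h A) + laplacian_e7 A *: proj_e7).
apply/eqP; rewrite -subr_eq0; apply/eqP/theta_psi_inj.
  by rewrite linearB /= symQ' symQ.
have ml := @multilinear_psi R.
by move=> x; rewrite -scaleN1r thetaDl // thetaZl // -eQ -eQ' mulN1r subrr.
Qed.

Lemma QhE A : sp6 A -> Qh A = laplacian_h A.
Proof.
move=> spA; rewrite /Qh laplacian_endoE //; apply/matrixP => i j.
transitivity ((ad_e7 (laplacian_h A) + laplacian_e7 A *: proj_e7) (lshift 1 i) (lshift 1 j)).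
  by rewrite !mxE.
rewrite mxE ad_e7_h [X in _ + X]mxE [proj_e7 _ _]mxE inord6_rshift.
have -> : (lshift 1 i == rshift 6 ord0 :> 'I_7) = false := @eq_lrshift 6 1 i ord0.
by rewrite mulr0 addr0.
Qed.

Lemma qE A : sp6 A -> q A = laplacian_e7 A.
Proof.
move=> spA; rewrite /q laplacian_endoE //.
transitivity ((ad_e7 (laplacian_h A) + laplacian_e7 A *: proj_e7) (rshift 6 0) (rshift 6 0)).
  by rewrite !mxE.
rewrite -inord6_rshift mxE ad_e7_row [X in _ + X]mxE [proj_e7 _ _]mxE.
by rewrite !eqxx mulr1 add0r.
Qed.

Lemma commutatorZl x A M : commutator (x *: A) M = x *: commutator A M.
Proof. by rewrite /commutator -scalemxAl -scalemxAr scalerBr. Qed.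

Lemma commutatorN A M : - commutator A M = commutator M A.
Proof. by rewrite /commutator opprB. Qed.

Lemma commutatorDl A M N : commutator (A + M) N = commutator A N + commutator M N.
Proof. by rewrite /commutator mulmxDl mulmxDr opprD addrACA. Qed.

Lemma bracket_flowE A : sp6 A -> bracket_flow A = coclosed_flow A.
Proof.
move=> spA; rewrite /bracket_flow QhE // qE // /coclosed_flow /laplacian_h.
rewrite commutatorDl !commutatorZl opprD -!scalerN !commutatorN addrA.
by [].
Qed.

Lemma sp6_bracket_flow A : sp6 A -> sp6 (bracket_flow A).
Proof.
move=> spA; rewrite /bracket_flow QhE // -scaleN1r; apply: sp6D; apply: sp6Z => //.
by apply: sp6_commutator => //; apply: sp6_laplacian_h.
Qed.

End Flow.

Theorem proposition4p5 (R : realType) :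
  (forall A : 'M[R]_6, coclosed A <-> sp6 A)
  /\ (forall A : 'M[R]_6, sp6 A -> sp6 (bracket_flow A))
  /\ (forall (I : set R) (A : R -> 'M[R]_6),
        open I -> is_interval I -> (forall t : R, I t -> sp6 (A t)) ->
        (solves (@bracket_flow R) I A <-> solves (@coclosed_flow R) I A)).
Proof.
split; first exact: coclosed_sp6.
split; first exact: sp6_bracket_flow.
move=> I A _ _ spA; split=> h t It; have := h t It; rewrite bracket_flowE //; exact: spA.
Qed.
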